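(* Let $\kappa>0$, $\epsilon>0$, $T>0$, let $B$ be a standard real Brownian motion, and let $Z$ be the solution on $[0,T]$ of the backward Loewner equation $$dZ_t=-\frac{2}{Z_t}\,dt+\sqrt{\kappa}\,dB_t,\qquad Z_0=\epsilon i.$$ Let $0=t_0<t_1<\cdots<t_N=T$ be a partition of $[0,T]$ and let $\{\widetilde Z_{t_k}\}_{0\le k\le N}$ be the Ninomiya–Victoir splitting approximation of $Z$ along this partition, with $\widetilde Z_0=Z_0$. Then for every $k$ with $0\le k\le N$, $$\mathbb{E}\big[\widetilde Z_{t_k}^2\big]=\mathbb{E}\big[Z_{t_k}^2\big],\qquad \mathbb{E}\big[\widetilde Z_{t_k}^4\big]=\mathbb{E}\big[Z_{t_k}^4\big].$$
   Context: The process $Z$ takes values in the upper half plane $\mathbb{H}=\{z\in\mathbb{C}:\operatorname{Im}z>0\}$, and its imaginary part is increasing in time. Write $h_k=t_{k+1}-t_k$ and $B_{s,t}=B_t-B_s$. The Ninomiya–Victoir splitting of the backward Loewner equation is defined by $\widetilde Z_0:=\epsilon i$ and, for $0\le k\le N-1$, $$\widetilde Z_{t_{k+1}}:=\sqrt{\Big(\sqrt{\widetilde Z_{t_k}^2-2h_k}+\sqrt{\kappa}\,B_{t_k,t_{k+1}}\Big)^2-2h_k}\,,$$ where the complex square roots are taken with values in $\mathbb{H}$ (for $z\in\mathbb{H}$ and $c\ge0$, the number $z^2-c$ has exactly one square root in $\mathbb{H}$). The partition is deterministic. The powers $Z^2$, $Z^4$ are complex powers (not powers of the modulus). *)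

(* Defs.v *)
From HB Require Import structures.
From mathcomp Require Import all_boot all_order all_algebra.
From mathcomp Require Import all_classical all_reals all_analysis.
From mathcomp Require Import complex.

Set Implicit Arguments.
Unset Strict Implicit.
Unset Printing Implicit Defensive.

Import Order.TTheory GRing.Theory Num.Theory.
Import numFieldNormedType.Exports.

Local Open Scope classical_set_scope.
Local Open Scope ring_scope.
Local Open Scope complex_scope.

Section ComplexValued.
Context (R : realType).

(* [R[i]] carries no measurable structure in the library: measurability,
   continuity and integration of complex-valued maps are componentwise. *)

Definition Cmeasurable_fun d (T : measurableType d) (D : set T)
    (f : T -> R[i]) : Prop :=
  measurable_fun D (fun x => complex.Re (f x)) /\
  measurable_fun D (fun x => complex.Im (f x)).

Definition Ccontinuous_within (D : set R) (f : R -> R[i]) : Prop :=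
  {within D, continuous (fun x => complex.Re (f x))} /\
  {within D, continuous (fun x => complex.Im (f x))}.

Definition Cintegral d (T : measurableType d)
    (mu : {measure set T -> \bar R}) (D : set T) (f : T -> R[i]) : R[i] :=
  (Rintegral mu D (fun x => complex.Re (f x))) +i*
  (Rintegral mu D (fun x => complex.Im (f x))).

Definition Cintegrable d (T : measurableType d)
    (mu : {measure set T -> \bar R}) (D : set T) (f : T -> R[i]) : Prop :=
  mu.-integrable D (fun x => (complex.Re (f x))%:E) /\
  mu.-integrable D (fun x => (complex.Im (f x))%:E).

(* Meaningful when [Cintegrable P setT X]. *)
Definition Cexpectation d (T : measurableType d) (P : probability T R)
    (X : T -> R[i]) : R[i] :=
  (fine 'E_P[fun x => complex.Re (X x)]) +i*
  (fine 'E_P[fun x => complex.Im (X x)]).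

(* The square root of [z] with values in the open upper half-plane;
   0 if there is none, i.e. if [z] is a nonnegative real. *)
Definition sqrtH (z : R[i]) : R[i] :=
  xget 0 [set w : R[i] | 0 < complex.Im w /\ w ^+ 2 = z].

Lemma sqrtH_uniq (z w : R[i]) :
  0 < complex.Im w -> w ^+ 2 = z -> sqrtH z = w.
Proof.
move=> w0 wz; apply: xget_unique => //= v [v0 vz].
have /eqP : v ^+ 2 == w ^+ 2 by rewrite vz wz.
move=> /eqP; rewrite eqf_sqr => /orP[/eqP//|/eqP vw].
by move: v0; rewrite vw; case: (w) w0 => a b /= b0; rewrite oppr_gt0 ltNge ltW.
Qed.

Lemma sqrtH_spec (z : R[i]) (c : R) : 0 < complex.Im z -> 0 <= c ->
  0 < complex.Im (sqrtH (z ^+ 2 - c%:C)) /\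
  sqrtH (z ^+ 2 - c%:C) ^+ 2 = z ^+ 2 - c%:C.
Proof.
move=> z0 c0; set y := z ^+ 2 - c%:C.
suff [w [w0 wy]] : exists w : R[i], 0 < complex.Im w /\ w ^+ 2 = y.
  by rewrite (sqrtH_uniq w0 wy).
have [s sy] : exists s : R[i], s ^+ 2 = y.
  by exists (sqrtc y); exact: sqr_sqrtc.
have [s0|s0|s0] := ltgtP 0 (complex.Im s).
- by exists s.
- exists (- s); rewrite sqrrN; split=> //.
  by move: s0; case: (s) => a b /=; rewrite oppr_gt0.
(* a real [s] is impossible: then [Re z = 0] and [y < 0 <= s ^+ 2] *)
exfalso; move: sy z0 s0; rewrite {}/y; case: s => a b.
case: z => p q /=; rewrite !expr2 => -[re im] q0 b0; subst b.
move: re im; rewrite !(mulr0, mul0r, addr0, subr0, oppr0) => re im.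
have p0 : p = 0.
  have /eqP : p * q = 0.
    move: im; rewrite [q * p]mulrC -mulr2n => /esym/eqP.
    by rewrite mulrn_eq0/= => /eqP.
  by rewrite mulf_eq0 (gt_eqF q0) orbF => /eqP.
have : a * a < 0.
  by rewrite re p0 mul0r sub0r -opprD oppr_lt0 ltr_pwDl// mulr_gt0.
by rewrite ltNge -expr2 sqr_ge0.
Qed.

End ComplexValued.

Section Processes.
Context (R : realType) (d : measure_display) (Omega : measurableType d)
  (P : probability Omega R).

Definition increment (B : R -> Omega -> R) (s t : R) (w : Omega) : R :=
  B t w - B s w.

(* [normal_prob m s] takes the standard deviation [s]. *)
Record brownian_motion (B : R -> {RV P >-> R}) : Prop := BrownianMotion {
  brownian_start : {ae P, forall w, B 0 w = 0};
  brownian_continuous :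
    {ae P, forall w, {within `[0, +oo[%classic, continuous (fun t : R => B t w)}};
  brownian_increment : forall s t : R, 0 <= s < t ->
    forall A : set R, measurable A ->
      P (increment B s t @^-1` A) = normal_prob 0 (Num.sqrt (t - s)) A;
  brownian_independent : forall (n : nat) (t : nat -> R) (A : nat -> set R),
    0 <= t 0%N -> (forall i, (i < n)%N -> t i < t i.+1) ->
    (forall i, (i < n)%N -> measurable (A i)) ->
    P (\bigcap_(i < n) (increment B (t i) (t i.+1) @^-1` A i)) =
    (\prod_(i < n) P (increment B (t i) (t i.+1) @^-1` A i))%E
}.

(* The noise is additive, so the stochastic differential equation
   dZ = - 2 / Z dt + sqrt kappa dB is a pathwise integral equation. *)
Record backward_loewner (kappa eps T : R) (B : R -> Omega -> R)
    (Z : R -> Omega -> R[i]) : Prop := BackwardLoewner {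
  loewner_measurable : forall t, 0 <= t <= T -> Cmeasurable_fun setT (Z t);
  loewner_start : {ae P, forall w, Z 0 w = 0 +i* eps};
  loewner_continuous :
    {ae P, forall w, Ccontinuous_within `[0, T]%classic (fun t => Z t w)};
  loewner_upper :
    {ae P, forall w, forall t, 0 <= t <= T -> 0 < complex.Im (Z t w)};
  loewner_equation : {ae P, forall w, forall t, 0 <= t <= T ->
    Z t w = Z 0 w
            - Cintegral lebesgue_measure `[0, t]%classic (fun s => 2 / Z s w)
            + (Num.sqrt kappa * B t w)%:C}
}.

End Processes.

Section Splitting.
Context (R : realType).

(* Only the values [t 0, ..., t N] matter. *)
Definition is_partition (T : R) (N : nat) (t : nat -> R) : Prop :=
  [/\ t 0%N = 0, t N = T & forall k, (k < N)%N -> t k < t k.+1].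

(* [ninomiya_victoir kappa eps B t k] is the approximation at time [t k]. *)
Fixpoint ninomiya_victoir (Omega : Type) (kappa eps : R) (B : R -> Omega -> R)
    (t : nat -> R) (k : nat) (w : Omega) : R[i] :=
  if k is k'.+1 then
    let h := t k'.+1 - t k' in
    let z := ninomiya_victoir kappa eps B t k' w in
    sqrtH ((sqrtH (z ^+ 2 - (2 * h)%:C)
            + (Num.sqrt kappa * (B (t k'.+1) w - B (t k') w))%:C) ^+ 2
           - (2 * h)%:C)
  else 0 +i* eps.

End Splitting.

(* Main.v *)
Require Import Defs.
From mathcomp Require Import all_boot all_order all_algebra.
From mathcomp Require Import all_classical all_reals all_analysis.
From mathcomp Require Import measurable_realfun complex.
From mathcomp Require Import ring lra.

(** Put [sigma = sqrt kappa].  One step of the splitting with step [h] and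
    noise increment [V] reads [W ^ 2 = z ^ 2 - 2 h] and
    [z' ^ 2 = (W + sigma V) ^ 2 - 2 h].  Since [V] is centred Gaussian of
    variance [h] and independent of [W], expanding the square and its square
    expresses the second and fourth moments of [z'] through those of [z]
    alone: the odd powers of [W], whose means are unknown, come with odd powers
    of [V].  The resulting recurrences are solved exactly, on every partition,
    by two polynomials in time ([ninomiya_victoir_moments]).

    The solution [Z] has the same moments, for a reason that needs no
    stochastic calculus.  As the noise is additive, the equation is an integral
    equation for each path, with a drift that is bounded and Lipschitz on
    [Im z >= eps], where both [Z] and the scheme stay.  A discrete Gronwall
    argument shows that, for almost every path, the scheme on the uniform grids
    of [[0, tau]] converges to [Z tau] ([splitting_cvg]).  Its
    distance to [sigma * (B tau - B 0)] is bounded uniformly in the grid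
    ([norm1_ninomiya_victoir_le]), so its powers up to the fourth are dominated
    by one integrable function, and the moments, which are the same for all
    grids, pass to the limit ([has_mean_dominated], [solution_moments]).

    The moments of a Brownian increment come from integrating the derivative
    of [x ^ q * exp (- x ^ 2 / (2 s ^ 2))] over the line, and the independence
    of the past and the next increment from the pi-lambda theorem applied to
    the sets cut out by finitely many increments. *)

Set Implicit Arguments.
Unset Strict Implicit.
Unset Printing Implicit Defensive.

Import Order.TTheory GRing.Theory Num.Theory.
Import numFieldNormedType.Exports.

Local Open Scope classical_set_scope.
Local Open Scope ring_scope.
Local Open Scope complex_scope.

(** * Complex arithmetic and the square root *)

Section ComplexEstimates.
Context (R : realType).
Implicit Types (z w : R[i]) (c m : R).

(** The sum of the moduli of the two coordinates: real-valued,
    submultiplicative, and compatible with the componentwise integrals. *)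
Definition norm1 z : R := `|complex.Re z| + `|complex.Im z|.

Lemma norm1_ge0 z : 0 <= norm1 z.
Proof. exact: addr_ge0. Qed.

Lemma norm1N z : norm1 (- z) = norm1 z.
Proof. by case: z => a b; rewrite /norm1/= !normrN. Qed.

Lemma norm1D z w : norm1 (z + w) <= norm1 z + norm1 w.
Proof.
case: z w => [a b] [a' b']; rewrite /norm1/= addrACA.
by rewrite lerD// ler_normD.
Qed.

Lemma norm1B z w : norm1 (z - w) <= norm1 z + norm1 w.
Proof. by rewrite -(norm1N w) norm1D. Qed.

Lemma norm1M z w : norm1 (z * w) <= norm1 z * norm1 w.
Proof.
case: z w => [a b] [a' b']; rewrite /norm1/=.
have h1 := ler_normB (a * a') (b * b').
have h2 := ler_normD (a * b') (b * a').
rewrite !normrM in h1 h2; lra.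
Qed.

Lemma norm1X z n : norm1 (z ^+ n) <= norm1 z ^+ n.
Proof.
elim: n => [|n IH]; first by rewrite !expr0 /norm1/= normr1 normr0 addr0.
rewrite !exprS (le_trans (norm1M _ _))// ler_wpM2l//.
exact: norm1_ge0.
Qed.

Lemma norm1_real (x : R) : norm1 x%:C = `|x|.
Proof. by rewrite /norm1/= normr0 addr0. Qed.

Lemma normr_Re_le z : `|complex.Re z| <= norm1 z.
Proof. by rewrite lerDl. Qed.

Lemma normr_Im_le z : `|complex.Im z| <= norm1 z.
Proof. by rewrite lerDr. Qed.

Lemma complex_Re_realM (x : R) z : complex.Re (x%:C * z) = x * complex.Re z.
Proof. by case: z => a b /=; rewrite mul0r subr0. Qed.

Lemma complex_Im_realM (x : R) z : complex.Im (x%:C * z) = x * complex.Im z.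
Proof. by case: z => a b /=; rewrite mul0r addr0. Qed.

Lemma complex_ReV z : complex.Re z^-1 =
  complex.Re z / (complex.Re z ^+ 2 + complex.Im z ^+ 2).
Proof. by case: z. Qed.

Lemma complex_ImV z : complex.Im z^-1 =
  - (complex.Im z / (complex.Re z ^+ 2 + complex.Im z ^+ 2)).
Proof. by case: z. Qed.

Lemma Im_gt0_neq0 z : 0 < complex.Im z -> z != 0.
Proof.
by case: z => a b /= b0; rewrite eq_complex/= negb_and (gt_eqF b0) orbT.
Qed.

(** Away from the real axis the drift [2 / z] is bounded. *)
Lemma norm1V_le z m : 0 < m -> m <= complex.Im z -> norm1 z^-1 <= 2 / m.
Proof.
move=> m0 mz; rewrite /norm1 complex_ReV complex_ImV normrN !normrM normfV.
set a := complex.Re z; set b := complex.Im z.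
have b0 : 0 < b := lt_le_trans m0 mz.
have s0 : 0 < a ^+ 2 + b ^+ 2 by have := sqr_ge0 a; nra.
rewrite (gtr0_norm s0) -mulrDl ler_pdivrMr// mulrC mulrA.
rewrite ler_pdivlMr// (gtr0_norm b0).
have := normr_ge0 a; rewrite -[a ^+ 2](real_normK (num_real a)).
move: `|a| => a' a'0.
suff : (a' + b) * b <= (a' ^+ 2 + b ^+ 2) * 2 by rewrite -/b in mz *; nra.
have := sqr_ge0 (a' - b); nra.
Qed.

(** [1 / z - 1 / w = - (1 / z) (1 / w) (z - w)], and both inverses are
    bounded. *)
Lemma norm1_invB_le z w m : 0 < m -> m <= complex.Im z -> m <= complex.Im w ->
  norm1 (z^-1 - w^-1) <= (2 / m) ^+ 2 * norm1 (z - w).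
Proof.
move=> m0 mz mw.
have z0 := Im_gt0_neq0 (lt_le_trans m0 mz).
have w0 := Im_gt0_neq0 (lt_le_trans m0 mw).
have -> : z^-1 - w^-1 = z^-1 * w^-1 * (- (z - w)) by field; rewrite z0 w0.
rewrite (le_trans (norm1M _ _))// norm1N ler_wpM2r ?norm1_ge0//.
rewrite (le_trans (norm1M _ _))// expr2.
by apply: ler_pM; rewrite ?norm1_ge0// norm1V_le.
Qed.

(** A closed form, from which measurability can be read off.  It also holds
    for nonnegative real [z]: then [q = 0], both sides are [0] because
    [sqrtH] has its default value and [0^-1 = 0]. *)
Lemma sqrtHE z :
  let q := Num.sqrt ((Num.sqrt (complex.Re z ^+ 2 + complex.Im z ^+ 2)
                      - complex.Re z) / 2) in
  sqrtH z = (complex.Im z / (2 * q)) +i* q.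
Proof.
case: z => a b /=; set r := Num.sqrt (_ + _); set q := Num.sqrt _.
have r0 : 0 <= r by exact: sqrtr_ge0.
have r2 : r ^+ 2 = a ^+ 2 + b ^+ 2 by rewrite sqr_sqrtr// addr_ge0// sqr_ge0.
have ar : a <= r.
  have := sqr_ge0 b; rewrite leNgt => b0; apply/negP => ra.
  nra.
have q2 : q ^+ 2 = (r - a) / 2 by rewrite sqr_sqrtr// divr_ge0// subr_ge0.
have [q0|q0] := ltP 0 q.
  apply: sqrtH_uniq => //=; rewrite expr2/=; congr (_ +i* _); last first.
    by field; rewrite gt_eqF.
  have q0' : q != 0 by rewrite gt_eqF.
  have -> : b / (2 * q) * (b / (2 * q)) - q * q =
            b ^+ 2 / (4 * q ^+ 2) - q ^+ 2 by field.
  have ra : r - a != 0.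
    by apply: contra_neq q0' => ra; apply/eqP; rewrite -sqrf_eq0 q2 ra mul0r.
  rewrite q2.
  have -> : b ^+ 2 = (r - a) * (r + a) by rewrite -subr_sqr r2; ring.
  by field.
have {}q0 : q = 0 by apply/eqP; rewrite eq_le q0 sqrtr_ge0.
have ra : r = a.
  by apply/eqP; rewrite -subr_eq0; move: q2; rewrite q0 expr0n/= => q2; lra.
have b0 : b = 0.
  by apply/eqP; rewrite -sqrf_eq0; apply/eqP; move: r2; rewrite ra; lra.
rewrite q0 mulr0 invr0 mulr0; apply: xgetPN => -[u v] [/= v0].
rewrite expr2 => -[e1 e2].
have u0 : u = 0.
  have /eqP : u * v = 0 by move: e2; rewrite b0; lra.
  by rewrite mulf_eq0 (gt_eqF v0) orbF => /eqP.
by move: e1; rewrite u0 -ra => e1; nra.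
Qed.

(** If [w = u + i v] is the root and [v < Im z], then [u v = Re z * Im z]
    forces [u ^ 2 >= (Re z) ^ 2], so that [Re (w ^ 2) > Re (z ^ 2)], against
    [w ^ 2 = z ^ 2 - c]. *)
Lemma Im_sqrtH_ge z c : 0 < complex.Im z -> 0 <= c ->
  complex.Im z <= complex.Im (sqrtH (z ^+ 2 - c%:C)).
Proof.
move=> z0 c0; have [] := sqrtH_spec z0 c0.
move: (sqrtH _); case: z z0 => x y /= y0; case=> u v /= v0.
rewrite !expr2 => -[e1 e2]; rewrite leNgt; apply/negP => vy.
have e3 : u * v = x * y by lra.
have ux : x ^+ 2 <= u ^+ 2.
  have : x ^+ 2 * v ^+ 2 <= (u * v) ^+ 2.
    rewrite e3 exprMn ler_wpM2l ?sqr_ge0//.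
    by rewrite ler_sqr ?nnegrE ltW.
  by rewrite exprMn ler_pM2r// exprn_gt0.
nra.
Qed.

(** Since [w ^+ 2 - z ^+ 2 = - c] for [w] the root of [z ^+ 2 - c], the
    displacement is [w - z = - c / (z + w)]. *)
Lemma sqrtH_subE z c : 0 < complex.Im z -> 0 <= c ->
  let w := sqrtH (z ^+ 2 - c%:C) in w - z = - c%:C * (z + w)^-1.
Proof.
move=> z0 c0 w; have [w0 w2] := sqrtH_spec z0 c0.
have zw : z + w != 0 by apply: Im_gt0_neq0; rewrite raddfD/= addr_gt0.
apply: (mulIf zw); rewrite mulfVK//.
have -> : (w - z) * (z + w) = w ^+ 2 - z ^+ 2 by ring.
rewrite w2; ring.
Qed.

(** Both [z] and the root lie above height [m], hence [z + w] lies above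
    height [2 m]. *)
Lemma norm1_sqrtH_sub_le z c m : 0 < m -> m <= complex.Im z -> 0 <= c ->
  norm1 (sqrtH (z ^+ 2 - c%:C) - z) <= c / m.
Proof.
move=> m0 mz c0; have z0 := lt_le_trans m0 mz.
rewrite sqrtH_subE//; apply: (le_trans (norm1M _ _)).
rewrite norm1N norm1_real ger0_norm// ler_wpM2l//.
have -> : m^-1 = 2 / (2 * m) by field; rewrite gt_eqF.
apply: norm1V_le; first by rewrite mulr_gt0.
rewrite raddfD/= mulr_natl mulr2n lerD//.
exact: le_trans mz (Im_sqrtH_ge z0 c0).
Qed.

End ComplexEstimates.

(** * Moments of the normal distribution *)

Section RealLineIntegral.
Context (R : realType).
Local Notation mu := (@lebesgue_measure R).

(** The fundamental theorem of calculus on the interval from [-n] to [n],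
    passing to the limit by dominated convergence. *)
Lemma integral_derivative_eq0 (F f : R -> R) :
  (forall x : R, is_derive x 1 F (f x)) -> continuous f ->
  mu.-integrable setT (EFin \o f) ->
  F n.+1%:R - F (- n.+1%:R) @[n --> \oo] --> (0 : R) ->
  (\int[mu]_x (f x)%:E = 0)%E.
Proof.
move=> dF cf intf F0.
(* Truncation to [-n.+1, n.+1] rather than [-n, n] avoids an empty interior. *)
pose A n : set R := `[- n.+1%:R, n.+1%:R]%classic.
pose f_ n x := (f x * \1_(A n) x)%:E.
have /measurable_EFinP mf := measurable_int _ intf.
have mf_ n : measurable_fun setT (f_ n).
  apply/measurable_EFinP; apply: measurable_funM => //.
  by apply: measurable_indic; exact: measurable_itv.
have f_f : {ae mu, forall x, setT x -> f_ ^~ x @ \oo --> (f x)%:E}.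
  apply: aeW => x _; apply: cvg_near_cst; near=> n.
  rewrite /f_ indicE mem_set/= ?mulr1// /A/= in_itv/= -ler_norml.
  rewrite (@le_trans _ _ n%:R)//; last by rewrite ler_nat.
  by near: n; exact: nbhs_infty_ger.
have f_le : {ae mu, forall x n, setT x -> (`|f_ n x| <= `|(f x)%:E|)%E}.
  apply: aeW => x n _; rewrite /f_ indicE !abse_EFin lee_fin normrM.
  by case: (_ \in _); rewrite ?normr1 ?normr0 ?mulr1 ?mulr0.
have [_ _] := @dominated_convergence _ _ R mu setT measurableT f_
  (EFin \o f) (abse \o (EFin \o f)) mf_ (measurable_int _ intf) f_f
  (integrable_abse intf) f_le.
have -> : [sequence (\int[mu]_x f_ n x)%E]_n =
          (fun n => (F n.+1%:R - F (- n.+1%:R))%:E).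
  apply/funext => n; rewrite /=.
  rewrite (_ : f_ n = (fun x => (f x)%:E) \_ (A n)); last first.
    by apply/funext => x; rewrite epatch_indic/= /f_ EFinM.
  rewrite -integral_mkcond EFinB.
  have n0 : - n.+1%:R < n.+1%:R :> R by rewrite gtrN.
  apply: (continuous_FTC2 n0).
  - exact: continuous_subspaceT.
  - split.
    + by move=> x _; have [] := dF x.
    + apply: cvg_at_right_filter; apply: differentiable_continuous.
      by apply/derivable1_diffP; have [] := dF (- n.+1%:R).
    + apply: cvg_at_left_filter; apply: differentiable_continuous.
      by apply/derivable1_diffP; have [] := dF (n.+1%:R).
  - by move=> x _; rewrite derive1E; have [_ ->] := dF x.
move=> h; apply/esym; apply: cvg_unique h => //.
by apply: cvg_EFin; [exact: nearW|exact: F0].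
Unshelve. all: by end_near. Qed.

End RealLineIntegral.

(** Absolutely continuous changes of measure go through the Radon-Nikodym
    derivative, which agrees almost everywhere with any given density. *)
Section Density.
Context d (T : measurableType d) (R : realType).
Variables (mu : {sigma_finite_measure set T -> \bar R}) (nu : probability T R).
Variable p : T -> R.
Hypotheses (numu : nu `<< mu) (intp : mu.-integrable setT (EFin \o p)).
Hypothesis nuE : forall A, measurable A -> nu A = (\int[mu]_(x in A) (p x)%:E)%E.

Let ae_eq_density :
  ae_eq mu setT (Radon_Nikodym_SigmaFinite.f nu mu) (EFin \o p).
Proof.
apply: integral_ae_eq => //.
- exact: Radon_Nikodym_SigmaFinite.f_integrable.
- exact: measurable_int intp.
- move=> A _ mA; rewrite -(Radon_Nikodym_SigmaFinite.f_integral numu)//.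
  exact: nuE.
Qed.

Let mf := measurable_int _ (Radon_Nikodym_SigmaFinite.f_integrable numu).

Lemma ge0_integral_density f : measurable_fun setT f -> (forall x, 0 <= f x)%E ->
  (\int[nu]_x f x = \int[mu]_x (f x * (p x)%:E))%E.
Proof.
move=> mf0 f0.
rewrite -(Radon_Nikodym_SigmaFinite.change_of_variables numu)//.
apply: ae_eq_integral => //.
- exact: emeasurable_funM.
- by apply: emeasurable_funM => //; exact: measurable_int intp.
- exact: ae_eqe_mul2l.
Qed.

Lemma integral_density f : nu.-integrable setT f ->
  (\int[nu]_x f x = \int[mu]_x (f x * (p x)%:E))%E.
Proof.
move=> intf; rewrite -(Radon_Nikodym_change_of_variables numu)//.
have mf0 := measurable_int _ intf.
apply: ae_eq_integral => //.
- by apply: emeasurable_funM.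
- by apply: emeasurable_funM => //; exact: measurable_int intp.
- apply: ae_eqe_mul2l; apply: ae_eq_trans ae_eq_density.
  exact/ae_eq_sym/ae_eq_Radon_Nikodym_SigmaFinite.
Qed.

End Density.

Section NormalMoments.
Context (R : realType) (s : R) (s_gt0 : 0 < s).
Local Notation mu := (@lebesgue_measure R).
Local Notation g := (normal_fun 0 s).
Local Notation g2 := (normal_fun 0 (Num.sqrt 2 * s)).

Let s_neq0 : s != 0. Proof. by rewrite gt_eqF. Qed.

Let g2E x : g2 x = expR (- (x ^+ 2 / (4 * s ^+ 2))).
Proof.
rewrite /normal_fun subr0 exprMn sqr_sqrtr// -mulNr; congr expR.
by field.
Qed.

(** A wider Gaussian dominates every monomial of degree at most four times
    the original one, because [y ^ 2 / 2 <= exp y] for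
    [y = x ^ 2 / (4 s ^ 2)]. *)
Let expr4_normal_fun_le x : x ^+ 4 * g x <= 32 * s ^+ 4 * g2 x.
Proof.
set y := x ^+ 2 / (4 * s ^+ 2).
have y0 : 0 <= y by rewrite divr_ge0 ?sqr_ge0// mulr_ge0// sqr_ge0.
have -> : g x = expR (- y) * expR (- y).
  by rewrite -expRD /normal_fun subr0; congr expR; rewrite /y; field.
rewrite g2E -/y mulrA ler_wpM2r ?expR_ge0//.
have -> : x ^+ 4 = 16 * s ^+ 4 * y ^+ 2 by rewrite /y; field.
rewrite expRN ler_pdivrMr ?expR_gt0//.
have h : y ^+ 2 <= 2 * expR y.
  have := expR_ge1Dxn 1 y0; rewrite (_ : 2`!%:R = 2 :> R)// => h.
  lra.
have s4 : 0 <= 16 * s ^+ 4 by rewrite mulr_ge0// exprn_ge0// ltW.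
have := ler_wpM2l s4 h; lra.
Qed.

Let normal_fun_le x : g x <= g2 x.
Proof.
rewrite g2E ler_expR subr0 mulNr lerN2 -mulr_natr.
have s2 : 0 < s ^+ 2 by rewrite exprn_gt0.
by rewrite ler_wpM2l ?sqr_ge0// lef_pV2 ?posrE; lra.
Qed.

Let exprn_normal_fun_le (j : nat) x : (j <= 4)%N ->
  `|x ^+ j * g x| <= (1 + 32 * s ^+ 4) * g2 x.
Proof.
move=> j4; rewrite normrM (ger0_norm (normal_fun_ge0 _ _ _)) normrX.
have h : `|x| ^+ j <= 1 + x ^+ 4.
  have -> : x ^+ 4 = `|x| ^+ 4.
    by rewrite -normrX ger0_norm// (exprM x 2 2) sqr_ge0.
  have [x1|/ltW x1] := leP `|x| 1.
    rewrite (@le_trans _ _ 1)//; first by rewrite exprn_ile1.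
    by rewrite lerDl exprn_ge0.
  by apply: le_trans (ler_weXn2l x1 j4) _; rewrite lerDr.
apply: (le_trans (ler_wpM2r (normal_fun_ge0 _ _ _) h)).
have := normal_fun_le x; have := expr4_normal_fun_le x; lra.
Qed.

Let integrable_normal_fun s' : s' != 0 ->
  mu.-integrable setT (EFin \o normal_fun 0 s').
Proof.
move=> s'0; have := integrableZl measurableT (normal_peak s')^-1
  (integrable_normal_pdf 0 s').
apply: eq_integrable => //= x _.
by rewrite normal_pdfE// -EFinM mulKf// gt_eqF// normal_peak_gt0.
Qed.

Let measurable_exprn_normal_fun j :
  measurable_fun setT (fun x : R => x ^+ j * g x).
Proof.
by apply: measurable_funM; [exact: measurable_funX|exact: measurable_normal_fun].
Qed.

Let integrable_exprn_normal_fun j : (j <= 4)%N ->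
  mu.-integrable setT (fun x : R => (x ^+ j * g x)%:E).
Proof.
move=> j4.
have s2 : Num.sqrt 2 * s != 0 by rewrite mulf_neq0// gt_eqF// sqrtr_gt0.
apply: (le_integrable measurableT _ _
  (integrableZl measurableT (1 + 32 * s ^+ 4) (integrable_normal_fun s2))).
- apply/measurable_EFinP; exact: measurable_exprn_normal_fun.
- move=> x _; rewrite lee_fin.
  by apply: le_trans (exprn_normal_fun_le x j4) _; exact: ler_norm.
Qed.

Let is_derive_exprn q (x : R) :
  is_derive x 1 (fun y : R => y ^+ q) (q%:R * x ^+ q.-1).
Proof.
rewrite (_ : (fun _ => _) = (@idfun R) ^+ q); last first.
  by apply/funext => y; rewrite exprfctE.
by apply: (is_derive_eq (is_deriveX _ _)); rewrite /GRing.scale/= mulr1.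
Qed.

Let is_derive_normal_fun (x : R) : is_derive x 1 g (- (x / s ^+ 2) * g x).
Proof.
have h : is_derive x 1 (fun x : R => - (x - 0) ^+ 2 / (s ^+ 2 *+ 2))
   (- (x / s ^+ 2)).
  rewrite (_ : (fun _ => _) =
    (- (s ^+ 2 *+ 2)^-1) \*: (fun y : R => y ^+ 2)); last first.
    apply/funext => y; rewrite subr0.
    by rewrite -[RHS]/(- (s ^+ 2 *+ 2)^-1 * y ^+ 2); field.
  apply: (is_derive_eq (is_deriveZ _ (is_derive_exprn 2 x))).
  by rewrite /GRing.scale/= expr1; field.
rewrite mulrC.
exact: (is_derive1_comp (is_derive_expR _) h).
Qed.

Let monomial_normal_fun q x : R := x ^+ q * g x.

Let is_derive_monomial_normal_fun q (x : R) :
  is_derive x 1 (monomial_normal_fun q)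
  (q%:R * (x ^+ q.-1 * g x) - (s ^+ 2)^-1 * (x ^+ q.+1 * g x)).
Proof.
apply: (is_derive_eq (is_deriveM (is_derive_exprn q x)
  (is_derive_normal_fun x))).
rewrite -[LHS]/(x ^+ q * (- (x / s ^+ 2) * g x) + g x * (q%:R * x ^+ q.-1)).
by rewrite (exprS x q); field.
Qed.

Let monomial_normal_fun_cvg0 q : (q <= 3)%N ->
  monomial_normal_fun q n.+1%:R - monomial_normal_fun q (- n.+1%:R)
    @[n --> \oo] --> (0 : R).
Proof.
move=> q3.
have bnd (x : R) : 1 <= `|x| -> `|monomial_normal_fun q x| <= 32 * s ^+ 4 / `|x|.
  move=> x1; have x0 : 0 < `|x| by exact: lt_le_trans x1.
  rewrite ler_pdivlMr// normrM (ger0_norm (normal_fun_ge0 _ _ _)) normrX.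
  rewrite mulrAC -exprSr.
  apply: (@le_trans _ _ (x ^+ 4 * g x)).
    rewrite ler_wpM2r ?normal_fun_ge0//.
    have -> : x ^+ 4 = `|x| ^+ 4.
      by rewrite -normrX ger0_norm// (exprM x 2 2) sqr_ge0.
    by rewrite ler_weXn2l.
  apply: (le_trans (expr4_normal_fun_le x)).
  have s4 : 0 <= 32 * s ^+ 4 by rewrite mulr_ge0// exprn_ge0// ltW.
  apply: ler_piMr => //; rewrite g2E expR_le1 oppr_le0.
  by rewrite divr_ge0 ?sqr_ge0// mulr_ge0// sqr_ge0.
rewrite -(subr0 0); apply: cvgB; apply: norm_cvg0;
  apply: (@squeeze_cvgr _ _ _ _ (cst 0) (fun n => 32 * s ^+ 4 * harmonic n));
  rewrite ?mulr0; try exact: cvg_cst; try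
  (by rewrite -(mulr0 (32 * s ^+ 4)); apply: cvgMr; exact: cvg_harmonic);
  apply: nearW => n; rewrite normr_ge0/=;
  apply: le_trans (bnd _ _) _; rewrite ?normrN ?ger0_norm// ?ler1n//.
Qed.

Let continuous_exprn_normal_fun j : continuous (fun x : R => x ^+ j * g x).
Proof.
move=> x; apply: cvgM; first exact: exprn_continuous.
by apply: differentiable_continuous; apply/derivable1_diffP;
  have [] := is_derive_normal_fun x.
Qed.

(** Integration by parts against the density, [g' = - x / s ^ 2 * g],
    raises the degree by two. *)
Let integral_normal_fun_recurrence q : (q <= 3)%N ->
  (\int[mu]_x (x ^+ q.+1 * g x)%:E =
   (s ^+ 2 * q%:R)%:E * \int[mu]_x (x ^+ q.-1 * g x)%:E)%E.
Proof.
move=> q3.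
have q4 : (q.-1 <= 4)%N by rewrite (leq_trans (leq_pred _))// ltnW.
have i1 := integrableZl measurableT q%:R (integrable_exprn_normal_fun q4).
have i2 := integrableZl measurableT (s ^+ 2)^-1
  (@integrable_exprn_normal_fun q.+1 q3).
have := integral_derivative_eq0 (is_derive_monomial_normal_fun q) _ _
  (monomial_normal_fun_cvg0 q3).
rewrite (_ : EFin \o _ = fun x => (q%:R%:E * (x ^+ q.-1 * g x)%:E) -
   (s ^+ 2)^-1%:E * (x ^+ q.+1 * g x)%:E)%E; last exact/funext.
move=> /(_ _ (integrableB measurableT i1 i2)).
have c : continuous (fun x : R => q%:R * (x ^+ q.-1 * g x) -
    (s ^+ 2)^-1 * (x ^+ q.+1 * g x)).
  move=> x; apply: cvgB; apply: cvgMr; exact: continuous_exprn_normal_fun.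
move=> /(_ c); under eq_integral do rewrite EFinB !EFinM.
rewrite integralB// !integralZl//; try exact: integrable_exprn_normal_fun.
move: (integrable_fin_num measurableT (integrable_exprn_normal_fun q4)).
move: (integrable_fin_num measurableT (@integrable_exprn_normal_fun q.+1 q3)).
case: (\int[mu]_x (x ^+ q.+1 * g x)%:E)%E => // a _.
case: (\int[mu]_x (x ^+ q.-1 * g x)%:E)%E => // b _.
rewrite -!EFinM -EFinB => -[] h; congr EFin.
have e : q%:R * b = (s ^+ 2)^-1 * a by apply/eqP; rewrite -subr_eq0; apply/eqP.
by rewrite -mulrA e; field.
Qed.

Let normal_pdfE0 x : normal_pdf 0 s x = normal_peak s * g x.
Proof. by rewrite normal_pdfE. Qed.

Let integrable_exprn_pdf j : (j <= 4)%N ->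
  mu.-integrable setT (fun x : R => (x ^+ j)%:E * (normal_pdf 0 s x)%:E)%E.
Proof.
move=> j4; have := integrableZl measurableT (normal_peak s)
  (integrable_exprn_normal_fun j4).
apply: eq_integrable => // x _.
by rewrite normal_pdfE0 -!EFinM mulrCA.
Qed.

Lemma integrable_exprn_normal_prob j : (j <= 4)%N ->
  (normal_prob 0 s).-integrable setT (fun x : R => (x ^+ j)%:E).
Proof.
move=> j4.
have mX : measurable_fun [set: R] (fun x : R => (x ^+ j)%:E).
  by apply/measurable_EFinP; exact: exprn_measurable.
apply/integrableP; split => //.
rewrite (@ge0_integral_density _ _ _ mu (normal_prob 0 s) (normal_pdf 0 s))//.
- have /integrableP[_] := integrable_exprn_pdf j4.
  apply: le_lt_trans; rewrite le_eqVlt; apply/orP; left; apply/eqP.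
  apply: eq_integral => x _; rewrite abseM; congr (_ * _)%E.
  by rewrite gee0_abs// lee_fin normal_pdf_ge0.
- exact: normal_prob_dominates.
- exact: integrable_normal_pdf.
- exact: measurableT_comp.
Qed.

Let integral_exprn_normal_prob j : (j <= 4)%N ->
  (\int[normal_prob 0 s]_x (x ^+ j)%:E =
   (normal_peak s)%:E * \int[mu]_x (x ^+ j * g x)%:E)%E.
Proof.
move=> j4.
rewrite (@integral_density _ _ _ mu (normal_prob 0 s) (normal_pdf 0 s))//.
- rewrite -integralZl//; last exact: integrable_exprn_normal_fun.
  by apply: eq_integral => x _; rewrite normal_pdfE0 -!EFinM mulrCA.
- exact: normal_prob_dominates.
- exact: integrable_normal_pdf.
- exact: integrable_exprn_normal_prob.
Qed.

(** The moments of order [0] and [q = 0] start the recurrence, whose factor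
    [q] makes the odd moments vanish. *)
Let normal_prob_recurrence q : (q <= 3)%N ->
  (\int[normal_prob 0 s]_x (x ^+ q.+1)%:E =
   (s ^+ 2 * q%:R)%:E * \int[normal_prob 0 s]_x (x ^+ q.-1)%:E)%E.
Proof.
move=> q3; rewrite !integral_exprn_normal_prob//.
  by rewrite integral_normal_fun_recurrence// muleCA.
by rewrite (leq_trans (leq_pred _))// ltnW.
Qed.

Let normal_prob_moment0 : (\int[normal_prob 0 s]_x (x ^+ 0)%:E = 1)%E.
Proof.
transitivity (\int[normal_prob 0 s]_(x in [set: R]) cst 1 x)%E.
  by apply: eq_integral => x _; rewrite expr0.
by rewrite integral_cst// mul1e; exact: probability_setT.
Qed.

Lemma normal_prob_moment1 : (\int[normal_prob 0 s]_x (x ^+ 1)%:E = 0)%E.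
Proof. by rewrite normal_prob_recurrence// mulr0 mul0e. Qed.

Lemma normal_prob_moment2 :
  (\int[normal_prob 0 s]_x (x ^+ 2)%:E = (s ^+ 2)%:E)%E.
Proof. by rewrite normal_prob_recurrence// normal_prob_moment0 mulr1 mule1. Qed.

Lemma normal_prob_moment3 : (\int[normal_prob 0 s]_x (x ^+ 3)%:E = 0)%E.
Proof. by rewrite normal_prob_recurrence// normal_prob_moment1 mule0. Qed.

Lemma normal_prob_moment4 :
  (\int[normal_prob 0 s]_x (x ^+ 4)%:E = (3 * s ^+ 4)%:E)%E.
Proof.
rewrite normal_prob_recurrence// normal_prob_moment2 -EFinM; congr EFin; ring.
Qed.

End NormalMoments.

(** * Independence *)

Section Independence.
Context (R : realType) (d : measure_display) (Omega : measurableType d)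
  (P : probability Omega R).

(** The sets independent of [E] form a lambda-system, so independence spreads
    from a pi-system to the sigma-algebra that it generates. *)
Lemma independent_sigma_algebra (G : set (set Omega)) (E : set Omega) :
  setI_closed G -> G `<=` measurable -> measurable E ->
  (forall A, G A -> P (A `&` E) = P A * P E)%E ->
  forall A, <<s G >> A -> measurable A /\ (P (A `&` E) = P A * P E)%E.
Proof.
move=> GI Gm mE GE.
suff : <<s G >> `<=` [set A | measurable A /\ (P (A `&` E) = P A * P E)%E].
  by move=> h A /h.
apply: lambda_system_subset => //; last first.
  by move=> A GA; split; [exact: Gm|exact: GE].
apply/dynkin_lambda_system; split.
- by split => //; rewrite setTI probability_setT mul1e.
- move=> A [mA AE]; split; first exact: measurableC.
  have -> : ~` A `&` E = E `\` A by rewrite setIC.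
  rewrite measureD//; last by rewrite ltey_eq fin_num_measure.
  have h1 : P E \is a fin_num by exact: fin_num_measure.
  have h2 : (1 +? - P A)%E by rewrite fin_num_adde_defr.
  rewrite probability_setC// muleBl// mul1e.
  by congr (_ - _)%E; rewrite setIC; exact: AE.
- move=> F tF FE.
  have mF n : measurable (F n) by have [] := FE n.
  split; first exact: bigcup_measurable.
  rewrite setI_bigcupl !measure_bigcup//.
  + have h1 : P E \is a fin_num by exact: fin_num_measure.
    rewrite muleC -(fineK h1) -nneseriesZl//; apply: eq_eseriesr => n _.
    by rewrite fineK// muleC; exact: (FE n).2.
  + by move=> n _; exact: measurableI.
  + by apply: trivIset_setIr.
Qed.

Definition independent_RV (X Y : Omega -> R) : Prop :=
  forall A C : set R, measurable A -> measurable C ->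
    P (X @^-1` A `&` Y @^-1` C) = (P (X @^-1` A) * P (Y @^-1` C))%E.

(** The joint law of an independent pair is the product of the marginal laws,
    and the expectation of the product is computed by Fubini's theorem. *)
Section Product.
Variables X Y : Omega -> R.
Hypotheses (mX : measurable_fun setT X) (mY : measurable_fun setT Y).
Hypothesis XY : independent_RV X Y.
Hypotheses (intX : P.-integrable setT (EFin \o X))
  (intY : P.-integrable setT (EFin \o Y)).

Let X' : {mfun Omega >-> R} := mfun_Sub (mem_set mX).
Let Y' : {mfun Omega >-> R} := mfun_Sub (mem_set mY).
Let Z : Omega -> R * R := fun w => (X w, Y w).
Let mZ : measurable_fun setT Z. Proof. exact: measurable_fun_pair. Qed.
Let Z' : {mfun Omega >-> (R * R)%type} := mfun_Sub (mem_set mZ).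
Let muX := distribution P X'.
Let muY := distribution P Y'.
Let muZ := distribution P Z'.

Let muZE A : measurable A -> (muX \x muY)%E A = muZ A.
Proof.
apply: product_measure_unique => A1 A2 mA1 mA2.
rewrite -(XY mA1 mA2); congr (P _).
Qed.

Let f (z : R * R) : \bar R := (z.1 * z.2)%:E.

Let mf : measurable_fun setT f.
Proof.
apply/measurable_EFinP; apply: measurable_funM;
  [exact: measurable_fst|exact: measurable_snd].
Qed.

Let int_dist (V : {mfun Omega >-> R}) : P.-integrable setT (EFin \o V) ->
  (distribution P V).-integrable setT (fun x : R => x%:E).
Proof.
move=> intV; apply: integrable_pushforward => //.
exact/measurable_EFinP.
Qed.

Let E_dist (V : {mfun Omega >-> R}) : P.-integrable setT (EFin \o V) ->
  (\int[distribution P V]_x x%:E = \int[P]_w (V w)%:E)%E.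
Proof.
by move=> intV; rewrite integral_distribution//; exact/measurable_EFinP.
Qed.

Let intf : (muX \x muY)%E.-integrable setT f.
Proof.
apply/integrable12ltyP => //.
have /integrableP[_ hX] := int_dist (V := X') intX.
have /integrableP[_ hY] := int_dist (V := Y') intY.
pose c := fine (\int[muY]_y `|y%:E|)%E.
have cE : (\int[muY]_y `|y%:E| = c%:E)%E.
  by rewrite fineK// ge0_fin_numE// integral_ge0.
rewrite (eq_integral (fun x : R => `|x%:E| * c%:E)%E); last first.
  move=> x _; rewrite -cE -ge0_integralZl//.
  - by apply: eq_integral => y _; rewrite -abseM -EFinM.
  - by apply: measurableT_comp => //; exact/measurable_EFinP.
rewrite ge0_integralZr//.
- by rewrite lte_mul_pinfty ?integral_ge0 ?ge0_fin_numE ?ltry// integral_ge0.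
- by apply: measurableT_comp => //; exact/measurable_EFinP.
- by rewrite lee_fin fine_ge0// integral_ge0.
Qed.

Lemma integrableM_independent : P.-integrable setT (fun w => (X w * Y w)%:E).
Proof.
have /integrableP[_ fi] := intf.
apply/integrableP; split.
  by apply/measurable_EFinP; exact: measurable_funM.
move: fi; rewrite (eq_measure_integral muZ); last by move=> A mA _; exact: muZE.
by rewrite ge0_integral_distribution//; exact: measurableT_comp.
Qed.

Lemma expectationM_independent : 
  ('E_P[fun w => (X w * Y w)%R] = 'E_P[X] * 'E_P[Y])%E.
Proof.
rewrite unlock.
have -> : (\int[P]_w (X w * Y w)%:E = \int[muZ]_z f z)%E.
  by rewrite integral_distribution//; exact: integrableM_independent.
rewrite -(eq_measure_integral muZ (m1 := muX \x muY)%E); last first.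
  by move=> A mA _; exact: muZE.
rewrite -integral12_prod_meas1//=.
rewrite -(E_dist (V := X') intX) -(E_dist (V := Y') intY).
have iY := int_dist (V := Y') intY.
have fY := integrable_fin_num measurableT iY.
rewrite -(fineK fY) -integralZr//; last exact: (int_dist (V := X') intX).
apply: eq_integral => x _; rewrite fineK// /fubini_F /f/=.
by rewrite -integralZl//; apply: eq_integral => y _; rewrite EFinM.
Qed.

End Product.

End Independence.

(** * Measurability and means of complex random variables *)

Section ComplexMeasurability.
Context (R : realType) (d : measure_display) (T : measurableType d).
Implicit Types X Y : T -> R[i].

Lemma Cmeasurable_cst (c : R[i]) : Cmeasurable_fun setT (fun _ : T => c).
Proof. by split; exact: measurable_cst. Qed.

Lemma Cmeasurable_real (f : T -> R) : measurable_fun setT f ->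
  Cmeasurable_fun setT (fun x => (f x)%:C).
Proof. by move=> mf; split => //=; exact: measurable_cst. Qed.

Lemma CmeasurableD X Y : Cmeasurable_fun setT X -> Cmeasurable_fun setT Y ->
  Cmeasurable_fun setT (fun x => X x + Y x).
Proof.
move=> [mX1 mX2] [mY1 mY2]; split.
  by under eq_fun do rewrite raddfD; exact: measurable_funD.
by under eq_fun do rewrite raddfD; exact: measurable_funD.
Qed.

Lemma CmeasurableM X Y : Cmeasurable_fun setT X -> Cmeasurable_fun setT Y ->
  Cmeasurable_fun setT (fun x => X x * Y x).
Proof.
move=> [mX1 mX2] [mY1 mY2]; split.
  rewrite (_ : (fun _ => _) = (fun x => complex.Re (X x) * complex.Re (Y x)
    - complex.Im (X x) * complex.Im (Y x))).
    by apply: measurable_funB; exact: measurable_funM.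
  by apply/funext => x; case: (X x) (Y x) => [? ?] [? ?].
rewrite (_ : (fun _ => _) = (fun x => complex.Re (X x) * complex.Im (Y x)
  + complex.Im (X x) * complex.Re (Y x))).
  by apply: measurable_funD; exact: measurable_funM.
by apply/funext => x; case: (X x) (Y x) => [? ?] [? ?].
Qed.

Lemma CmeasurableX X n : Cmeasurable_fun setT X ->
  Cmeasurable_fun setT (fun x => X x ^+ n).
Proof.
move=> mX; elim: n => [|n IH]; first exact: Cmeasurable_cst.
by under eq_fun do rewrite exprS; exact: CmeasurableM.
Qed.

Lemma Cmeasurable_sqrtH X : Cmeasurable_fun setT X ->
  Cmeasurable_fun setT (fun x => sqrtH (X x)).
Proof.
move=> [mX1 mX2].
have msqrt (f : T -> R) : measurable_fun setT f ->
    measurable_fun setT (fun x => Num.sqrt (f x)).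
  move=> mf; apply: (measurableT_comp _ mf).
  by apply: continuous_measurable_fun; exact: sqrt_continuous.
pose q x := Num.sqrt ((Num.sqrt (complex.Re (X x) ^+ 2 + complex.Im (X x) ^+ 2)
                      - complex.Re (X x)) / 2).
have mq : measurable_fun setT q.
  apply: (msqrt); apply: measurable_funM => //; apply: measurable_funB => //.
  by apply: msqrt; apply: measurable_funD; exact: measurable_funX.
split; last by under eq_fun do rewrite sqrtHE/=.
rewrite (_ : (fun _ => _) = (fun x => complex.Im (X x) * (2 * q x) `^ (-1))).
  apply: measurable_funM => //.
  by apply: (measurableT_comp (measurable_powR _)); exact: measurable_funM.
apply/funext => x; rewrite sqrtHE/= powR_inv1// mulr_ge0//.
exact: sqrtr_ge0.
Qed.

Lemma Cmeasurable_ninomiya_victoir (kappa eps : R) (B : R -> T -> R)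
    (t : nat -> R) k :
  (forall i, (i < k)%N -> measurable_fun setT (increment B (t i) (t i.+1))) ->
  Cmeasurable_fun setT (ninomiya_victoir kappa eps B t k).
Proof.
elim: k => [|k IH] mB; first exact: Cmeasurable_cst.
have {}IH := IH (fun i ik => mB i (ltnW ik)).
have msub X (c : R[i]) : Cmeasurable_fun setT X ->
    Cmeasurable_fun setT (fun x => X x - c).
  by move=> mX; apply: CmeasurableD => //; exact: Cmeasurable_cst.
rewrite /=; apply: Cmeasurable_sqrtH; apply: (msub); apply: CmeasurableX.
apply: CmeasurableD; last first.
  apply: Cmeasurable_real; apply: measurable_funM => //.
  exact: mB.
by apply: Cmeasurable_sqrtH; apply: (msub); exact: CmeasurableX.
Qed.

End ComplexMeasurability.

Section ComplexMean.
Context (R : realType) (d : measure_display) (Omega : measurableType d)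
  (P : probability Omega R).
Implicit Types X Y : Omega -> R[i].

Lemma CexpectationE X : Cexpectation P X = Cintegral P setT X.
Proof. by rewrite /Cexpectation unlock. Qed.

(** Integrability and the value of the mean travel together through sums,
    multiples and independent products. *)
Definition has_mean X (m : R[i]) : Prop :=
  Cintegrable P setT X /\ Cexpectation P X = m.

Lemma has_mean_eq X Y m m' : (forall w, X w = Y w) -> m = m' ->
  has_mean X m -> has_mean Y m'.
Proof. by move=> /funext -> ->. Qed.

Lemma has_mean_cst (c : R[i]) : has_mean (fun=> c) c.
Proof.
split; first by split; exact: finite_measure_integrable_cst.
transitivity (fine 'E_P[cst (complex.Re c)] +i* fine 'E_P[cst (complex.Im c)]).
  by [].
by rewrite !expectation_cst; case: c.
Qed.

Lemma has_meanD X Y m m' : has_mean X m -> has_mean Y m' ->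
  has_mean (fun w => X w + Y w) (m + m').
Proof.
move=> [[X1 X2] <-] [[Y1 Y2] <-]; split.
  split; [move: (integrableD measurableT X1 Y1)
         |move: (integrableD measurableT X2 Y2)];
    by apply: eq_integrable => // w _; rewrite raddfD EFinD.
rewrite !CexpectationE /Cintegral.
under eq_Rintegral do rewrite raddfD.
under [in X in _ +i* X]eq_Rintegral do rewrite raddfD.
by rewrite !RintegralD.
Qed.

Lemma has_meanZ (c : R[i]) X m : has_mean X m ->
  has_mean (fun w => c * X w) (c * m).
Proof.
case: c => a b [[X1 X2] <-].
have e1 w : complex.Re ((a +i* b) * X w) =
    a * complex.Re (X w) - b * complex.Im (X w) by case: (X w).
have e2 w : complex.Im ((a +i* b) * X w) =
    a * complex.Im (X w) + b * complex.Re (X w) by case: (X w).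
have i1 r : P.-integrable setT (EFin \o (fun w => r * complex.Re (X w))).
  have := integrableZl measurableT r X1; apply: eq_integrable => //.
have i2 r : P.-integrable setT (EFin \o (fun w => r * complex.Im (X w))).
  have := integrableZl measurableT r X2; apply: eq_integrable => //.
split.
  split.
    have := integrableB measurableT (i1 a) (i2 b); apply: eq_integrable => //.
    by move=> w _; rewrite e1 EFinB.
  have := integrableD measurableT (i2 a) (i1 b); apply: eq_integrable => //.
  by move=> w _; rewrite e2 EFinD.
rewrite !CexpectationE /Cintegral.
move/funext : e1 => ->; move/funext : e2 => ->.
by rewrite RintegralB// RintegralD// !RintegralZl.
Qed.

(** The odd powers of the noise have mean zero, and through this lemma they
    cancel the unknown odd moments of the scheme. *)
Lemma has_mean_independent X (V : Omega -> R) m v :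
  Cmeasurable_fun setT X -> measurable_fun setT V ->
  independent_RV P (fun w => complex.Re (X w)) V ->
  independent_RV P (fun w => complex.Im (X w)) V ->
  has_mean X m -> P.-integrable setT (EFin \o V) -> ('E_P[V] = v%:E)%E ->
  has_mean (fun w => X w * (V w)%:C) (m * v%:C).
Proof.
move=> [mX1 mX2] mV XV1 XV2 [[X1 X2] <-] iV EV.
have e1 w : complex.Re (X w * (V w)%:C) = complex.Re (X w) * V w.
  by case: (X w) => a b /=; rewrite mulr0 subr0.
have e2 w : complex.Im (X w * (V w)%:C) = complex.Im (X w) * V w.
  by case: (X w) => a b /=; rewrite mulr0 add0r.
split.
  split.
    have := integrableM_independent mX1 mV XV1 X1 iV.
    by apply: eq_integrable => // w _; rewrite e1.
  have := integrableM_independent mX2 mV XV2 X2 iV.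
  by apply: eq_integrable => // w _; rewrite e2.
rewrite /Cexpectation (funext e1) (funext e2).
rewrite (expectationM_independent mX1)// (expectationM_independent mX2)// EV.
have f1 : ('E_P[fun w => complex.Re (X w)] \is a fin_num)%E.
  by rewrite unlock; exact: integrable_fin_num.
have f2 : ('E_P[fun w => complex.Im (X w)] \is a fin_num)%E.
  by rewrite unlock; exact: integrable_fin_num.
rewrite -(fineK f1) -(fineK f2) -!EFinM /=.
by apply/eqP; rewrite eq_complex/= !mulr0 subr0 add0r !eqxx.
Qed.

Lemma Cintegrable_le X (h : Omega -> R) : Cmeasurable_fun setT X ->
  P.-integrable setT (EFin \o h) -> (forall w, norm1 (X w) <= h w) ->
  Cintegrable P setT X.
Proof.
move=> [mX1 mX2] ih Xh; split.
- apply: (le_integrable measurableT _ _ ih); first exact/measurable_EFinP.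
  move=> w _; rewrite lee_fin (le_trans (normr_Re_le _))//.
  by rewrite (le_trans (Xh w))// ler_norm.
- apply: (le_integrable measurableT _ _ ih); first exact/measurable_EFinP.
  move=> w _; rewrite lee_fin (le_trans (normr_Im_le _))//.
  by rewrite (le_trans (Xh w))// ler_norm.
Qed.

End ComplexMean.

(** * Moments of the splitting scheme *)

Section SplittingStep.
Context (R : realType).
Implicit Types (z : R[i]) (h m : R).

(** The flow of the drift [dz = - (2 / z) dt] over the time [h / 2], along
    which [d (z ^ 2) = - 4 dt]. *)
Definition half_step h z : R[i] := sqrtH (z ^+ 2 - (2 * h)%:C).

Section Step.
Variables (h m : R) (z : R[i]).
Hypotheses (h_ge0 : 0 <= h) (m_gt0 : 0 < m) (mz : m <= complex.Im z).

Let z_gt0 : 0 < complex.Im z. Proof. exact: lt_le_trans mz. Qed.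

Let h2_ge0 : 0 <= 2 * h. Proof. by rewrite mulr_ge0. Qed.

Lemma half_step_sqr : half_step h z ^+ 2 = z ^+ 2 - (2 * h)%:C.
Proof. by have [] := sqrtH_spec z_gt0 h2_ge0. Qed.

Lemma Im_half_step_ge : m <= complex.Im (half_step h z).
Proof. exact: le_trans mz (Im_sqrtH_ge z_gt0 h2_ge0). Qed.

Lemma norm1_half_step_sub_le : norm1 (half_step h z - z) <= 2 * h / m.
Proof. exact: norm1_sqrtH_sub_le. Qed.

Lemma half_step_subE : half_step h z - z = - (2 * h)%:C * (z + half_step h z)^-1.
Proof. exact: sqrtH_subE. Qed.

End Step.

Lemma ninomiya_victoirS (T : Type) kappa eps (B : R -> T -> R) (t : nat -> R)
    k x :
  let h := t k.+1 - t k in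
  ninomiya_victoir kappa eps B t k.+1 x =
  half_step h (half_step h (ninomiya_victoir kappa eps B t k x)
    + (Num.sqrt kappa * (B (t k.+1) x - B (t k) x))%:C).
Proof. by []. Qed.

Section Bounds.
Variables (T : Type) (kappa eps : R) (B : R -> T -> R) (t : nat -> R).
Hypothesis eps_gt0 : 0 < eps.
Local Notation Z := (ninomiya_victoir kappa eps B t).

Lemma Im_ninomiya_victoir_ge k x : (forall i, (i < k)%N -> t i < t i.+1) ->
  eps <= complex.Im (Z k x).
Proof.
elim: k => [//|n IH] tS.
have h0 : 0 <= t n.+1 - t n by rewrite subr_ge0 ltW// tS.
rewrite ninomiya_victoirS; apply: Im_half_step_ge => //.
rewrite raddfD/= addr0; apply: Im_half_step_ge => //.
by apply: IH => i ik; apply: tS; exact: ltnW.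
Qed.

(** Off the driving noise, the scheme moves with speed at most [4 / eps];
    hence a dominating function that depends on the terminal time only, not
    on the partition. *)
Lemma norm1_ninomiya_victoir_le k x : (forall i, (i < k)%N -> t i < t i.+1) ->
  norm1 (Z k x - (Num.sqrt kappa * (B (t k) x - B (t 0%N) x))%:C)
  <= eps + 4 * (t k - t 0%N) / eps.
Proof.
elim: k => [_|n IH tS].
  rewrite !subrr !mulr0 mul0r subr0 addr0.
  by rewrite /norm1/= normr0 add0r gtr0_norm.
have h0 : 0 <= t n.+1 - t n by rewrite subr_ge0 ltW// tS.
have tSn i : (i < n)%N -> t i < t i.+1 by move=> ik; apply: tS; exact: ltnW.
rewrite ninomiya_victoirS; have {IH} := IH tSn.
have := Im_ninomiya_victoir_ge x tSn; move: (Z n x) => z mz IH.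
set h := t n.+1 - t n in h0 *.
set w := half_step h z; set v := w + _.
have mw : eps <= complex.Im w by exact: Im_half_step_ge.
have mv : eps <= complex.Im v by rewrite /v raddfD/= addr0.
rewrite (_ : half_step h v - _ = (half_step h v - v) + (w - z) +
  (z - (Num.sqrt kappa * (B (t n) x - B (t 0%N) x))%:C)); last first.
  by rewrite /v !(rmorphM, rmorphB)/=; ring.
have e1 := norm1_half_step_sub_le h0 eps_gt0 mv.
have e2 := norm1_half_step_sub_le h0 eps_gt0 mz.
apply: (le_trans (norm1D _ _)).
have := norm1D (half_step h v - v) (w - z).
rewrite -/w in e2.
have -> : eps + 4 * (t n.+1 - t 0%N) / eps =
  2 * h / eps + 2 * h / eps + (eps + 4 * (t n - t 0%N) / eps).
  by rewrite /h; field; rewrite gt_eqF.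
lra.
Qed.

End Bounds.

End SplittingStep.

Section BrownianIncrements.
Context (R : realType) (d : measure_display) (Omega : measurableType d)
  (P : probability Omega R).
Variables (B : R -> {RV P >-> R}) (B_brownian : brownian_motion B).
Local Notation incr := (increment (fun t w => B t w)).

Lemma measurable_increment s t : measurable_fun setT (incr s t).
Proof. exact: measurable_funB. Qed.

Let measurable_increment_lebesgue s t :
  measurable_fun setT (incr s t : Omega -> measurableTypeR R).
Proof. exact: measurable_increment. Qed.

(* The codomain is the Borel space that carries [normal_prob]. *)
Let incr_dist s t : {mfun Omega >-> measurableTypeR R} :=
  @mfun_Sub _ _ Omega (measurableTypeR R) _
    (mem_set (measurable_increment_lebesgue s t)).

Let dist_incrE s t : 0 <= s < t -> forall A, measurable A ->
  distribution P (incr_dist s t) A = normal_prob 0 (Num.sqrt (t - s)) A.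
Proof. by move=> st A mA; exact: (brownian_increment B_brownian st mA). Qed.

Let integral_incr s t j : 0 <= s < t -> (j <= 4)%N ->
  P.-integrable setT (fun w => (incr s t w ^+ j)%:E) /\
  (\int[P]_w (incr s t w ^+ j)%:E =
   \int[normal_prob 0 (Num.sqrt (t - s))]_x (x ^+ j)%:E)%E.
Proof.
move=> st j4; have /andP[s0 st'] := st.
have sd0 : 0 < Num.sqrt (t - s) by rewrite sqrtr_gt0 subr_gt0.
have mX : measurable_fun [set: R] (fun x : R => (x ^+ j)%:E).
  by apply/measurable_EFinP; exact: exprn_measurable.
have changeE (f : measurableTypeR R -> \bar R) :
    (\int[normal_prob 0 (Num.sqrt (t - s))]_x f x =
    \int[distribution P (incr_dist s t)]_x f x)%E.
  by apply: eq_measure_integral => A mA _; exact/esym/dist_incrE.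
have i : P.-integrable setT (fun w => (incr s t w ^+ j)%:E).
  apply/integrableP; split.
    by apply/measurable_EFinP/measurable_funX; exact: measurable_increment.
  have /integrableP[_] := integrable_exprn_normal_prob sd0 j4.
  rewrite changeE.
  by rewrite ge0_integral_distribution//; exact: measurableT_comp.
by split => //; rewrite changeE integral_distribution.
Qed.

Lemma integrable_increment s t j : 0 <= s <= t -> (j <= 4)%N ->
  P.-integrable setT (fun w => (incr s t w ^+ j)%:E).
Proof.
move=> /andP[s0]; rewrite le_eqVlt => /predU1P[<-|st] j4; last first.
  by have [] := @integral_incr s t j _ j4; rewrite ?s0.
have [[+ _] _] := has_mean_cst P (0 ^+ j)%:C.
by apply: eq_integrable => // w _; rewrite /increment subrr.
Qed.

Section Moments.
Variables (s t : R).
Hypothesis st : 0 <= s < t.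

Let sd_gt0 : 0 < Num.sqrt (t - s).
Proof. by move: st => /andP[_ st']; rewrite sqrtr_gt0 subr_gt0. Qed.

Let sd2 : Num.sqrt (t - s) ^+ 2 = t - s.
Proof. by move: st => /andP[_ st']; rewrite sqr_sqrtr// subr_ge0 ltW. Qed.

Lemma increment_moment1 : ('E_P[fun w => (incr s t w ^+ 1)%R] = 0%:E)%E.
Proof. by rewrite unlock (integral_incr st _).2// normal_prob_moment1. Qed.

Lemma increment_moment2 : ('E_P[fun w => (incr s t w ^+ 2)%R] = (t - s)%:E)%E.
Proof. by rewrite unlock (integral_incr st _).2// normal_prob_moment2// sd2. Qed.

Lemma increment_moment3 : ('E_P[fun w => (incr s t w ^+ 3)%R] = 0%:E)%E.
Proof. by rewrite unlock (integral_incr st _).2// normal_prob_moment3. Qed.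

Lemma increment_moment4 :
  ('E_P[fun w => (incr s t w ^+ 4)%R] = (3 * (t - s) ^+ 2)%:E)%E.
Proof.
rewrite unlock (integral_incr st _).2// normal_prob_moment4//.
by rewrite (exprM _ 2 2) sd2.
Qed.

End Moments.

Section Past.
Variables (t : nat -> R) (k : nat).
Hypotheses (t0 : 0 <= t 0%N) (tS : forall i, (i <= k)%N -> t i < t i.+1).

(** The pi-system generating the past of the increment over
    [[t k, t k.+1]]. *)
Definition increment_boxes : set (set Omega) :=
  [set A | exists2 C : nat -> set R, (forall i, measurable (C i)) &
    A = \bigcap_(i < k) (incr (t i) (t i.+1) @^-1` C i)].

Let boxesI : setI_closed increment_boxes.
Proof.
move=> A1 A2 [C1 mC1 ->] [C2 mC2 ->]; exists (fun i => C1 i `&` C2 i).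
  by move=> i; exact: measurableI.
by rewrite bigcapI.
Qed.

Let incr_measurable s s' C : measurable C -> measurable (incr s s' @^-1` C).
Proof.
by move=> mC; rewrite -[X in measurable X]setTI; exact: measurable_increment.
Qed.

Let boxes_measurable : increment_boxes `<=` measurable.
Proof.
move=> A [C mC ->].
by rewrite bigcap_mkord; apply: bigsetI_measurable => i _; exact: incr_measurable.
Qed.

Let boxes_independent A C : increment_boxes A -> measurable C ->
  (P (A `&` incr (t k) (t k.+1) @^-1` C) =
   P A * P (incr (t k) (t k.+1) @^-1` C))%E.
Proof.
move=> [D mD ->] mC.
(* One more side: the condition on the next increment closes a box. *)
pose D' i := if i == k then C else D i.
have mD' i : measurable (D' i) by rewrite /D'; case: ifP.
have D'k : D' k = C by rewrite /D' eqxx.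
have D'D i : (i < k)%N -> D' i = D i by move=> ik; rewrite /D' ltn_eqF.
have -> : \bigcap_(i < k) (incr (t i) (t i.+1) @^-1` D i) =
          \bigcap_(i < k) (incr (t i) (t i.+1) @^-1` D' i).
  by apply: eq_bigcapr => i ik; rewrite D'D.
rewrite -{1}D'k.
have -> : \bigcap_(i < k) (incr (t i) (t i.+1) @^-1` D' i) `&`
    incr (t k) (t k.+1) @^-1` D' k =
    \bigcap_(i < k.+1) (incr (t i) (t i.+1) @^-1` D' i).
  by rewrite !bigcap_mkord big_ord_recr.
rewrite !(brownian_independent B_brownian)// ?big_ord_recr/= ?D'k//.
by move=> i ik; apply: tS; exact: ltnW.
Qed.

(** On boxes this follows from the product formulas for [k.+1] and for [k]
    increments; the pi-lambda theorem carries it over to their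
    sigma-algebra. *)
Lemma past_increment_independent (X : Omega -> R) (g : R -> R) :
  measurable_fun setT g ->
  measurable_fun setT (X : g_sigma_algebraType increment_boxes -> R) ->
  independent_RV P X (fun w => g (incr (t k) (t k.+1) w)).
Proof.
move=> mg mX A C mA mC.
have mgC : measurable (g @^-1` C).
  by rewrite -[X in measurable X]setTI; exact: mg.
have := @independent_sigma_algebra _ _ _ P increment_boxes
  (incr (t k) (t k.+1) @^-1` (g @^-1` C)) boxesI boxes_measurable
  (incr_measurable _ _ mgC) _ (X @^-1` A).
move=> h; have [|_ ->//] := h (fun D GD => boxes_independent GD mgC).
by have := mX measurableT A mA; rewrite setTI.
Qed.

Lemma measurable_past_increment i : (i < k)%N ->
  measurable_fun setT
    (incr (t i) (t i.+1) : g_sigma_algebraType increment_boxes -> R).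
Proof.
move=> ik _ C mC; rewrite setTI; apply: sub_sigma_algebra.
exists (fun j => if j == i then C else setT).
  by move=> j; case: ifP.
apply/seteqP; split=> w /=.
  by move=> Cw j _; case: eqP => // ->.
by move=> /(_ i ik); rewrite /= eqxx.
Qed.

End Past.

End BrownianIncrements.

Section SplittingMoments.
Context (R : realType) (d : measure_display) (Omega : measurableType d)
  (P : probability Omega R).
Variables (kappa eps : R) (kappa_gt0 : 0 < kappa) (eps_gt0 : 0 < eps).
Variables (B : R -> {RV P >-> R}) (B_brownian : brownian_motion B).
Local Notation incr := (increment (fun t w => B t w)).
Local Notation sigma := (Num.sqrt kappa).
Local Notation NV t := (ninomiya_victoir kappa eps (fun t w => B t w) t).

(** Dominates every power of degree at most four of a quantity bounded by
    [C + c * |y|]: the summand [1] takes care of the lower powers, and [8] comes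
    from [(a + b) ^ 4 <= 8 (a ^ 4 + b ^ 4)]. *)
Definition quartic_bound (C c y : R) : R := 1 + 8 * (C ^+ 4 + c ^+ 4 * y ^+ 4).

Lemma exprn_le_quartic_bound (C c x y : R) p : 0 <= C -> 0 <= c -> 0 <= x ->
  x <= C + c * `|y| -> (p <= 4)%N -> x ^+ p <= quartic_bound C c y.
Proof.
move=> C0 c0 x0 xC p4; rewrite /quartic_bound.
have -> : c ^+ 4 * y ^+ 4 = (c * `|y|) ^+ 4.
  by rewrite exprMn -normrX [`|y ^+ 4|]ger0_norm// (exprM y 2 2) sqr_ge0.
have b0 : 0 <= c * `|y| by rewrite mulr_ge0.
move: (c * `|y|) b0 xC => b b0 xC.
apply: (@le_trans _ _ (1 + x ^+ 4)).
  have [x1|/ltW x1] := leP x 1.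
    rewrite (@le_trans _ _ 1)//; first by rewrite exprn_ile1.
    by rewrite lerDl exprn_ge0.
  by apply: le_trans (ler_weXn2l x1 p4) _; rewrite lerDr.
rewrite lerD2l (@le_trans _ _ ((C + b) ^+ 4))//.
  by rewrite lerXn2r ?nnegrE ?addr_ge0.
have h2 : (C + b) ^+ 2 <= 2 * (C ^+ 2 + b ^+ 2).
  by have := sqr_ge0 (C - b); nra.
have h4 : (C ^+ 2 + b ^+ 2) ^+ 2 <= 2 * (C ^+ 4 + b ^+ 4).
  by have := sqr_ge0 (C ^+ 2 - b ^+ 2); nra.
rewrite (exprM _ 2 2) (@le_trans _ _ ((2 * (C ^+ 2 + b ^+ 2)) ^+ 2))//.
  by rewrite lerXn2r// ?nnegrE ?sqr_ge0// mulr_ge0// addr_ge0// sqr_ge0.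
by rewrite exprMn; lra.
Qed.

Lemma integrable_quartic_bound (C c s t : R) : 0 <= s <= t ->
  P.-integrable setT (fun w => (quartic_bound C c (incr s t w))%:E).
Proof.
move=> st.
have i4 := integrable_increment B_brownian st (leqnn 4).
have [[i0 _] _] := has_mean_cst P (1 + 8 * C ^+ 4)%:C.
have := integrableD measurableT i0 (integrableZl measurableT (8 * c ^+ 4) i4).
apply: eq_integrable => // w _.
by rewrite -EFinM -EFinD /quartic_bound/=; congr EFin; ring.
Qed.

Lemma Cintegrable_exprn (X : Omega -> R[i]) (C c s t : R) p : 0 <= C -> 0 <= c ->
  0 <= s <= t -> Cmeasurable_fun setT X ->
  (forall w, norm1 (X w) <= C + c * `|incr s t w|) -> (p <= 4)%N ->
  Cintegrable P setT (fun w => X w ^+ p).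
Proof.
move=> C0 c0 st mX XC p4.
apply: (Cintegrable_le (CmeasurableX _ mX) (integrable_quartic_bound C c st)).
move=> w; rewrite (le_trans (norm1X _ _))//.
by apply: exprn_le_quartic_bound => //; exact: norm1_ge0.
Qed.

(** The common values of the second and fourth moments at time [s]: the
    solutions of [m2' = kappa - 4] and [m4' = (6 kappa - 8) m2], which is what
    taking means in the stochastic differentials of [Z ^ 2] and [Z ^ 4] gives. *)
Definition second_moment (s : R) : R := - eps ^+ 2 + (kappa - 4) * s.

Definition fourth_moment (s : R) : R :=
  eps ^+ 4 - (6 * kappa - 8) * eps ^+ 2 * s
  + (6 * kappa - 8) * (kappa - 4) * s ^+ 2 / 2.

Section Partition.
Variables (t : nat -> R) (t0 : t 0%N = 0).

Lemma partition_ge0 k : (forall i, (i < k)%N -> t i < t i.+1) -> 0 <= t k.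
Proof.
elim: k => [|k IH] tS; first by rewrite t0.
rewrite (le_trans (IH _))// => [i ik|]; last by rewrite ltW// tS.
by apply: tS; exact: ltnW.
Qed.

Lemma norm1_ninomiya_victoir_le_increment k w :
  (forall i, (i < k)%N -> t i < t i.+1) ->
  norm1 (NV t k w) <= eps + 4 * t k / eps + sigma * `|incr 0 (t k) w|.
Proof.
move=> tS.
have h := norm1_ninomiya_victoir_le kappa (fun t w => B t w) eps_gt0 w tS.
rewrite t0 subr0 in h.
have := norm1D (NV t k w - (sigma * incr 0 (t k) w)%:C)
  (sigma * incr 0 (t k) w)%:C.
rewrite subrK norm1_real normrM (ger0_norm (sqrtr_ge0 _)).
by move=> /le_trans -> //; rewrite lerD2r.
Qed.

Lemma Cmeasurable_half_step d' (T' : measurableType d') h (X : T' -> R[i]) :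
  Cmeasurable_fun setT X -> Cmeasurable_fun setT (fun w => half_step h (X w)).
Proof.
move=> mX; apply: Cmeasurable_sqrtH.
by apply: CmeasurableD; [exact: CmeasurableX|exact: Cmeasurable_cst].
Qed.

(** Write [W] for the scheme after the first half step and [V] for the
    following increment, so that the next square is
    [(W + sigma V) ^ 2 - 2 h] with [W ^ 2 = NV ^ 2 - 2 h]. *)
Section OneStep.
Variables (k : nat) (tS : forall i, (i < k.+1)%N -> t i < t i.+1).
Let h := t k.+1 - t k.
Let V w := incr (t k) (t k.+1) w.
Let W w := half_step h (NV t k w).

Let tSk i : (i < k)%N -> t i < t i.+1.
Proof. by move=> ik; apply: tS; exact: ltnW. Qed.

Let tk0 : 0 <= t k. Proof. exact: partition_ge0. Qed.

Let h_gt0 : 0 < h. Proof. by rewrite subr_gt0 tS. Qed.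

Let step_itv : 0 <= t k < t k.+1. Proof. by rewrite tk0 tS. Qed.

Let Imz w : eps <= complex.Im (NV t k w).
Proof. exact: Im_ninomiya_victoir_ge. Qed.

Let mW : Cmeasurable_fun setT W.
Proof.
apply: Cmeasurable_half_step; apply: Cmeasurable_ninomiya_victoir => i _.
exact: measurable_increment.
Qed.

Let mW_past : Cmeasurable_fun setT
  (W : g_sigma_algebraType (increment_boxes B t k) -> R[i]).
Proof.
apply: Cmeasurable_half_step.
apply: (@Cmeasurable_ninomiya_victoir _ _
  (g_sigma_algebraType (increment_boxes B t k))) => i ik.
exact: measurable_past_increment.
Qed.

Let intW p : (p <= 4)%N -> Cintegrable P setT (fun w => W w ^+ p).
Proof.
have a0 : 0 <= eps + 4 * t k / eps + 2 * h / eps.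
  by rewrite !addr_ge0 ?divr_ge0 ?mulr_ge0// ltW.
apply: (Cintegrable_exprn a0 (sqrtr_ge0 kappa) (_ : 0 <= 0 <= t k) mW).
  by rewrite lexx tk0.
move=> w; rewrite -(subrK (NV t k w) (W w)) (le_trans (norm1D _ _))//.
have := norm1_half_step_sub_le (ltW h_gt0) eps_gt0 (Imz w).
have := norm1_ninomiya_victoir_le_increment w tSk.
by rewrite -/(W w); lra.
Qed.

Let WV p j v : (p <= 4)%N -> (j <= 4)%N ->
  ('E_P[fun w => (V w ^+ j)%R] = v%:E)%E ->
  has_mean P (fun w => W w ^+ p * (V w ^+ j)%:C)
             (Cexpectation P (fun w => W w ^+ p) * v%:C).
Proof.
move=> p4 j4 Ev.
have [mRe mIm] := CmeasurableX p mW_past.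
have t00 : 0 <= t 0%N by rewrite t0.
have mX : measurable_fun [set: R] (fun x : R => x ^+ j).
  exact: exprn_measurable.
apply: has_mean_independent => //.
- exact: CmeasurableX.
- by apply: measurable_funX; exact: measurable_increment.
- exact: (past_increment_independent B_brownian t00 tS mX mRe).
- exact: (past_increment_independent B_brownian t00 tS mX mIm).
- by split=> //; exact: intW.
- by apply: integrable_increment => //; case/andP: step_itv => -> /ltW.
Qed.

Let v1 : ('E_P[fun w => (V w ^+ 1)%R] = 0%:E)%E.
Proof. exact: increment_moment1. Qed.
Let v2 : ('E_P[fun w => (V w ^+ 2)%R] = h%:E)%E.
Proof. exact: increment_moment2. Qed.
Let v3 : ('E_P[fun w => (V w ^+ 3)%R] = 0%:E)%E.
Proof. exact: increment_moment3. Qed.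
Let v4 : ('E_P[fun w => (V w ^+ 4)%R] = (3 * h ^+ 2)%:E)%E.
Proof. exact: increment_moment4. Qed.

Let sigma2 : sigma%:C ^+ 2 = kappa%:C :> R[i].
Proof. by rewrite -rmorphXn/= sqr_sqrtr// ltW. Qed.

Let W2E w : W w ^+ 2 = NV t k w ^+ 2 - (2 * h)%:C.
Proof. exact: half_step_sqr (ltW h_gt0) eps_gt0 (Imz w). Qed.

Let NVS2 w : NV t k.+1 w ^+ 2 = (W w + (sigma * V w)%:C) ^+ 2 - (2 * h)%:C.
Proof.
rewrite ninomiya_victoirS; apply: (half_step_sqr (ltW h_gt0) eps_gt0).
by rewrite raddfD/= addr0; exact: Im_half_step_ge (ltW h_gt0) eps_gt0 (Imz w).
Qed.

Section Recurrence.
Variables m2 m4 : R[i].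
Hypothesis mean_sqr : has_mean P (fun w => NV t k w ^+ 2) m2.
Hypothesis mean_quart : has_mean P (fun w => NV t k w ^+ 4) m4.

Let EW2 : Cexpectation P (fun w => W w ^+ 2) = m2 - (2 * h)%:C.
Proof.
have := has_meanD mean_sqr (has_mean_cst P (- (2 * h)%:C)).
by case=> _ <-; congr (Cexpectation _ _); apply/funext => w; rewrite W2E.
Qed.

Let EW4 : Cexpectation P (fun w => W w ^+ 4) =
  m4 - (4 * h)%:C * m2 + (4 * h ^+ 2)%:C.
Proof.
have := has_meanD (has_meanD mean_quart (has_meanZ (- (4 * h)%:C) mean_sqr))
  (has_mean_cst P (4 * h ^+ 2)%:C).
rewrite mulNr => -[_ <-]; congr (Cexpectation _ _); apply/funext => w.
rewrite (exprM _ 2 2) W2E; ring.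
Qed.

Lemma ninomiya_victoir_step_second_moment :
  has_mean P (fun w => NV t k.+1 w ^+ 2) (m2 + ((kappa - 4) * h)%:C).
Proof.
have h20 : has_mean P (fun w => W w ^+ 2) (m2 - (2 * h)%:C).
  by split; [exact: intW|exact: EW2].
have h11 := has_meanZ (2 * sigma%:C) (@WV 1 1 0 isT isT v1).
have h02 := has_meanZ kappa%:C (@WV 0 2 h isT isT v2).
have h00 := has_mean_cst P (- (2 * h)%:C).
apply: has_mean_eq (has_meanD (has_meanD (has_meanD h20 h11) h02) h00).
  move=> w; rewrite NVS2 -sigma2 !rmorphM/= !rmorphXn/=; ring.
rewrite (_ : Cexpectation P (fun w => W w ^+ 0) = 1); last first.
  by have [_ <-] := has_mean_cst P 1.
rewrite !(rmorphM, rmorphB)/=; ring.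
Qed.

Lemma ninomiya_victoir_step_fourth_moment :
  has_mean P (fun w => NV t k.+1 w ^+ 4)
    (m4 + ((6 * kappa - 8) * h)%:C * m2
     + ((3 * kappa ^+ 2 - 16 * kappa + 16) * h ^+ 2)%:C).
Proof.
have h40 : has_mean P (fun w => W w ^+ 4)
    (m4 - (4 * h)%:C * m2 + (4 * h ^+ 2)%:C).
  by split; [exact: intW|exact: EW4].
have h20 : has_mean P (fun w => W w ^+ 2) (m2 - (2 * h)%:C).
  by split; [exact: intW|exact: EW2].
have h31 := has_meanZ (4 * sigma%:C) (@WV 3 1 0 isT isT v1).
have h22 := has_meanZ (6 * kappa%:C) (@WV 2 2 h isT isT v2).
have h13 := has_meanZ (4 * sigma%:C * kappa%:C) (@WV 1 3 0 isT isT v3).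
have h04 := has_meanZ (kappa%:C ^+ 2) (@WV 0 4 _ isT isT v4).
have {}h20 := has_meanZ (- (4 * h)%:C) h20.
have h11 := has_meanZ (- (8 * h)%:C * sigma%:C) (@WV 1 1 0 isT isT v1).
have h02 := has_meanZ (- (4 * h)%:C * kappa%:C) (@WV 0 2 h isT isT v2).
have h00 := has_mean_cst P (4 * h ^+ 2)%:C.
have := has_meanD h40 (has_meanD h31 (has_meanD h22 (has_meanD h13
  (has_meanD h04 (has_meanD h20 (has_meanD h11 (has_meanD h02 h00))))))).
apply: has_mean_eq.
  (* The square of [W ^ 2 + 2 sigma W V + kappa V ^ 2 - 2 h]. *)
  move=> w; rewrite (exprM (NV t k.+1 w) 2 2) NVS2 -sigma2 !rmorphM/=.
  by rewrite !rmorphXn/=; ring.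
rewrite (_ : Cexpectation P (fun w => W w ^+ 0) = 1); last first.
  by have [_ <-] := has_mean_cst P 1.
rewrite EW2 !(rmorphM, rmorphB, rmorphD, rmorphXn)/=; ring.
Qed.

End Recurrence.

End OneStep.

(** The polynomials obey exactly the one-step recurrences of the scheme,
    whatever the steps are. *)
Lemma ninomiya_victoir_moments k : (forall i, (i < k)%N -> t i < t i.+1) ->
  has_mean P (fun w => NV t k w ^+ 2) (second_moment (t k))%:C /\
  has_mean P (fun w => NV t k w ^+ 4) (fourth_moment (t k))%:C.
Proof.
elim: k => [|k IH] tS.
  rewrite t0 /second_moment /fourth_moment; split.
    apply: has_mean_eq (has_mean_cst P ((0 +i* eps) ^+ 2)) => //.
    rewrite mulr0 addr0 expr2; apply/eqP; rewrite eq_complex/=.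
    by rewrite !mul0r mulr0 addr0 sub0r expr2 !eqxx.
  apply: has_mean_eq (has_mean_cst P ((0 +i* eps) ^+ 4)) => //.
  rewrite expr0n/= !(mulr0, mul0r, addr0, subr0) !exprS expr0.
  apply/eqP; rewrite eq_complex/=; apply/andP; split; apply/eqP; ring.
have [h2 h4] := IH (fun i ik => tS i (ltnW ik)).
split.
  apply: has_mean_eq (ninomiya_victoir_step_second_moment tS h2) => //.
  by rewrite -rmorphD/= /second_moment; congr (_%:C); ring.
apply: has_mean_eq (ninomiya_victoir_step_fourth_moment tS h2 h4) => //.
rewrite -rmorphM/= -!rmorphD/= /second_moment /fourth_moment.
by congr (_%:C); field.
Qed.

End Partition.

End SplittingMoments.

(** * Pathwise convergence of the splitting scheme *)

Section Paths.
Context (R : realType).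
Local Notation mu := (@lebesgue_measure R).

(** Heine's theorem on a segment, in terms of the real metric. *)
Lemma segment_uniform_continuity (a c : R) (g : R -> R) :
  {within `[a, c], continuous g} -> forall e, 0 < e ->
  \forall r \near 0^'+, forall s u, s \in `[a, c] -> u \in `[a, c] ->
    `|s - u| < r -> `|g s - g u| <= e.
Proof.
move=> /subspace_continuousP cg e e0.
have /compact_near_coveringP/near_covering_withinP cov := @segment_compact R a c.
pose Q r s := forall u, u \in `[a, c] -> `|s - u| < r -> `|g s - g u| <= e.
have : \forall r \near (0 : R)^'+, `[a, c] `<=` Q r.
  apply: cov => x /= xac.
  have /cvgrPdist_lt/(_ _ (divr_gt0 e0 (ltr0Sn R 1))) := cg x xac.
  rewrite near_withinE => /nbhs_ballP[/= r r0 hr].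
  have r20 : 0 < r / 2 by rewrite divr_gt0.
  exists (ball x (r / 2), [set r' | 0 < r' < r / 2]) => /=.
    split; first exact: nbhsx_ballx.
    near=> r'; apply/andP; split; near: r'.
      exact: nbhs_right_gt.
    exact: nbhs_right_lt.
  move=> [x' r'] /= [xx' /andP[r'0 r'r]] x'ac u uac ux'.
  have h1 : `|g x - g x'| < e / 2.
    apply: hr => //; apply: le_ball xx'; lra.
  have h2 : `|g x - g u| < e / 2.
    apply: hr => //; rewrite /ball/= in xx' *.
    have := ler_distD x' x u; lra.
  have := ler_distD (g x) (g x') (g u); rewrite (distrC (g x') (g x)); lra.
by apply: filterS => r Qr s u sac uac; exact: Qr.
Unshelve. all: by end_near. Qed.

Lemma norm1_le2 (w : R[i]) (M : R) :
  `|complex.Re w| <= M -> `|complex.Im w| <= M -> norm1 w <= 2 * M.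
Proof. by rewrite /norm1; lra. Qed.

Lemma Rintegral_sub_cst_le (f : R -> R) (c M s t : R) : s <= t ->
  mu.-integrable `]s, t] (EFin \o f) ->
  (forall u, u \in `]s, t] -> `|f u - c| <= M) ->
  `|\int[mu]_(u in `]s, t]) f u - (t - s) * c| <= (t - s) * M.
Proof.
move=> st intf fM.
have muE : fine (mu `]s, t]) = t - s.
  rewrite lebesgue_measure_itv/= lte_fin.
  by case: ltgtP st => //= ->; rewrite subrr.
have mI : measurable (`]s, t]%classic : set (measurableTypeR R)).
  exact: measurable_itv.
have intc r : mu.-integrable `]s, t] (EFin \o cst r).
  apply/integrableP; split; first exact/measurable_EFinP.
  rewrite (eq_integral (cst `|r|%:E))// integral_cst//=.
  rewrite lebesgue_measure_itv/=.
  by case: ifP => _; rewrite -?EFinB -?EFinM ?mule0 ltry.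
rewrite (_ : (t - s) * c = \int[mu]_(u in `]s, t]) cst c u); last first.
  by rewrite Rintegral_cst// muE mulrC.
rewrite -RintegralB//.
have intfc : mu.-integrable `]s, t] (EFin \o (fun u => f u - c)).
  have := integrableB mI intf (intc c).
  by apply: eq_integrable.
apply: (le_trans (le_normr_Rintegral _ intfc)) => //.
rewrite (_ : (t - s) * M = \int[mu]_(u in `]s, t]) cst M u); last first.
  by rewrite Rintegral_cst// muE mulrC.
apply: le_Rintegral => //.
exact: (integrable_norm intfc).
Qed.

Section Solution.
Variables (Omega : Type) (B : R -> Omega -> R) (w0 : Omega).
Variables (T eps kappa : R) (z : R -> R[i]) (eps_gt0 : 0 < eps).
Local Notation b := (B ^~ w0).
Local Notation sigma := (Num.sqrt kappa).
Hypothesis z_start : z 0 = 0 +i* eps.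
Hypothesis z_continuous : Ccontinuous_within `[0, T] z.
Hypothesis z_upper : forall t, 0 <= t <= T -> 0 < complex.Im (z t).
Hypothesis z_equation : forall t, 0 <= t <= T ->
  z t = z 0 - Cintegral mu `[0, t] (fun s => 2 / z s) + (sigma * b t)%:C.

Let f s : R[i] := 2 / z s.

Let ReE s : complex.Re (f s) =
  2 * (complex.Re (z s) / (complex.Re (z s) ^+ 2 + complex.Im (z s) ^+ 2)).
Proof.
by rewrite /f -[2](rmorph_nat (real_complex R)) complex_Re_realM complex_ReV.
Qed.

Let ImE s : complex.Im (f s) =
  - (2 * (complex.Im (z s) / (complex.Re (z s) ^+ 2 + complex.Im (z s) ^+ 2))).
Proof.
rewrite /f -[2](rmorph_nat (real_complex R)) complex_Im_realM complex_ImV.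
by rewrite mulrN.
Qed.

Let f_continuous : Ccontinuous_within `[0, T] f.
Proof.
have [/subspace_continuousP cRe /subspace_continuousP cIm] := z_continuous.
have n0 x : `[0, T]%classic x ->
    complex.Re (z x) ^+ 2 + complex.Im (z x) ^+ 2 != 0.
  rewrite /= in_itv/= => /z_upper zx; rewrite gt_eqF//.
  by rewrite ltr_wpDl ?sqr_ge0// exprn_gt0.
have cn x : `[0, T]%classic x ->
    complex.Re (z s) ^+ 2 + complex.Im (z s) ^+ 2 @[s --> within `[0, T] (nbhs x)]
    --> complex.Re (z x) ^+ 2 + complex.Im (z x) ^+ 2.
  move=> xT; rewrite !expr2; under eq_fun do rewrite !expr2.
  by apply: cvgD; apply: cvgM; (exact: cRe || exact: cIm).
split; apply/subspace_continuousP => x xT.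
  rewrite /from_subspace ReE; under eq_fun do rewrite ReE.
  apply: cvgM; first exact: cvg_cst.
  by apply: cvgM; [exact: cRe|apply: cvgV; [exact: n0|exact: cn]].
rewrite /from_subspace ImE; under eq_fun do rewrite ImE.
apply: cvgN; apply: cvgM; first exact: cvg_cst.
by apply: cvgM; [exact: cIm|apply: cvgV; [exact: n0|exact: cn]].
Qed.

Let integrable_f t : t <= T ->
  mu.-integrable `[0, t] (EFin \o (fun s => complex.Re (f s))) /\
  mu.-integrable `[0, t] (EFin \o (fun s => complex.Im (f s))).
Proof.
move=> tT; have [c1 c2] := f_continuous.
have sub : `[0, t] `<=` `[0, T]%classic by apply: subset_itvl; rewrite bnd_simp.
split; apply: continuous_compact_integrable; try exact: segment_compact.
  exact: continuous_subspaceW sub c1.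
exact: continuous_subspaceW sub c2.
Qed.

(** The imaginary part increases, because [Im (2 / z) <= 0]. *)
Lemma Im_solution_ge t : 0 <= t <= T -> eps <= complex.Im (z t).
Proof.
move=> t0T; have /andP[t0 tT] := t0T.
rewrite z_equation// z_start raddfD/= addr0 lerDl oppr_ge0.
rewrite -oppr_ge0 -mulN1r -RintegralZl//; last by have [] := integrable_f tT.
apply: Rintegral_ge0 => s /=; rewrite in_itv/= => /andP[s0 st].
have zs : 0 < complex.Im (z s) by rewrite z_upper// s0 (le_trans st).
rewrite -/(f s) ImE mulN1r opprK mulr_ge0//; apply: divr_ge0; first exact: ltW.
by rewrite addr_ge0// sqr_ge0.
Qed.

Let f_int s t := (\int[mu]_(u in `]s, t]) complex.Re (f u)) +i*
                 (\int[mu]_(u in `]s, t]) complex.Im (f u)).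

Let z_increment s t : 0 <= s -> s <= t -> t <= T ->
  z t = z s - f_int s t + (sigma * (b t - b s))%:C.
Proof.
move=> s0 st tT.
have [i1 i2] := integrable_f tT.
have e : f_int s t =
    Cintegral mu `[0, t] f - Cintegral mu `[0, s] f.
  rewrite /f_int /Cintegral.
  by rewrite -(Rintegral_itvB i1) ?bnd_simp// -(Rintegral_itvB i2) ?bnd_simp.
have zt : z t = z 0 - Cintegral mu `[0, t] f + (sigma * b t)%:C.
  by apply: z_equation; rewrite (le_trans s0 st).
have zs : z s = z 0 - Cintegral mu `[0, s] f + (sigma * b s)%:C.
  by apply: z_equation; rewrite s0 (le_trans st).
by rewrite e zt zs !(rmorphM, rmorphB)/=; ring.
Qed.

Let f_int_le s t (c : R[i]) M : 0 <= s -> s <= t -> t <= T ->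
  (forall u, s <= u <= t -> norm1 (f u - c) <= M) ->
  norm1 (f_int s t - (t - s)%:C * c) <= 2 * ((t - s) * M).
Proof.
move=> s0 st tT fM.
have [i1 i2] := integrable_f tT.
have sub : `]s, t] `<=` `[0, t]%classic.
  by move=> u /=; rewrite !in_itv/= => /andP[/ltW su ->]; rewrite (le_trans s0).
have mst : measurable (`]s, t]%classic : set (measurableTypeR R)).
  exact: measurable_itv.
have m0t : measurable (`[0, t]%classic : set (measurableTypeR R)).
  exact: measurable_itv.
have j1 := integrableS m0t mst sub i1.
have j2 := integrableS m0t mst sub i2.
have fM' u : u \in `]s, t] -> norm1 (f u - c) <= M.
  by rewrite in_itv/= => /andP[/ltW su ut]; rewrite fM// su.
apply: norm1_le2.
  rewrite (_ : complex.Re _ = \int[mu]_(u in `]s, t]) complex.Re (f u)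
    - (t - s) * complex.Re c); last by case: (c) => x y /=; rewrite mul0r subr0.
  apply: Rintegral_sub_cst_le => // u /fM'; apply: le_trans.
  by rewrite -raddfB; exact: normr_Re_le.
rewrite (_ : complex.Im _ = \int[mu]_(u in `]s, t]) complex.Im (f u)
    - (t - s) * complex.Im c); last by case: (c) => x y /=; rewrite mul0r addr0.
apply: Rintegral_sub_cst_le => // u /fM'; apply: le_trans.
by rewrite -raddfB; exact: normr_Im_le.
Qed.

Let solution_increment_le s t : 0 <= s -> s <= t -> t <= T ->
  norm1 (z t - z s - (sigma * (b t - b s))%:C) <= 8 * (t - s) / eps.
Proof.
move=> s0 st tT; rewrite (z_increment s0 st tT).
rewrite (_ : _ - _ = - (f_int s t - (t - s)%:C * 0)); last by ring.
rewrite norm1N.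
have -> : 8 * (t - s) / eps = 2 * ((t - s) * (4 / eps)).
  by field; rewrite gt_eqF.
apply: f_int_le => // u /andP[su ut]; rewrite subr0.
apply: (le_trans (norm1M _ _)).
rewrite (_ : norm1 2 = 2); last first.
  by rewrite -[2](rmorph_nat (real_complex R)) norm1_real ger0_norm.
have -> : 4 / eps = 2 * (2 / eps) by field; rewrite gt_eqF.
rewrite ler_wpM2l// norm1V_le// Im_solution_ge// (le_trans s0 su).
exact: le_trans ut tT.
Qed.

(** The two half steps move by [- h] times the inverses of the midpoints of
    their endpoints, while the solution moves by the integral of
    [- (1 / z + 1 / z)]; both midpoints are near the path [z], and inversion
    is Lipschitz. *)
Lemma splitting_local_error s t eta (Z : R[i]) :
  0 <= s -> s <= t -> t <= T ->
  (forall u, s <= u <= t -> norm1 (z u - z s) <= eta) ->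
  eps <= complex.Im Z ->
  norm1 (half_step (t - s) (half_step (t - s) Z + (sigma * (b t - b s))%:C) - z t)
  <= (1 + 16 / eps ^+ 2 * (t - s)) * norm1 (Z - z s)
    + (t - s) * (8 / eps ^+ 2 * (3 * eta + 12 * (t - s) / eps)).
Proof.
move=> s0 st tT zeta epsZ; pose h := t - s; rewrite -/h.
set w := half_step h Z; set V := _%:C; set v := w + V; set Z' := half_step h v.
have h0 : 0 <= h by rewrite subr_ge0.
have epsw : eps <= complex.Im w by exact: Im_half_step_ge.
have epsv : eps <= complex.Im v by rewrite /v raddfD/= addr0.
have epsZ' : eps <= complex.Im Z' by exact: Im_half_step_ge.
have wZ : norm1 (w - Z) <= 2 * h / eps by exact: norm1_half_step_sub_le.
have Z'v : norm1 (Z' - v) <= 2 * h / eps by exact: norm1_half_step_sub_le.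
have half (x : R[i]) : norm1 (x / 2) = norm1 x / 2.
  rewrite -[2](rmorph_nat (real_complex R)) -fmorphV/= /norm1; case: x => x y /=.
  rewrite !mulr0 subr0 add0r !normrM (gtr0_norm (_ : 0 < 2^-1)) ?invr_gt0//.
  by rewrite mulrDl.
pose m1 := (Z + w) / 2; pose m2 := (v + Z') / 2.
have Imhalf (x y : R[i]) : eps <= complex.Im x -> eps <= complex.Im y ->
    eps <= complex.Im ((x + y) / 2).
  rewrite -[2](rmorph_nat (real_complex R)) -fmorphV/=.
  case: x y => [? x] [? y] /=.
  by rewrite mulr0 add0r; lra.
have epsm1 : eps <= complex.Im m1 by exact: Imhalf.
have epsm2 : eps <= complex.Im m2 by exact: Imhalf.
have Imneq0 (x : R[i]) : eps <= complex.Im x -> x != 0.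
  by move=> ex; apply: Im_gt0_neq0; exact: lt_le_trans ex.
have c2 : 2 != 0 :> R[i] by rewrite pnatr_eq0.
pose c := m1^-1 + m2^-1.
have Z'E : Z' = Z - h%:C * c + V.
  have e1 := half_step_subE h0 eps_gt0 epsZ; rewrite -/w in e1.
  have e2 := half_step_subE h0 eps_gt0 epsv; rewrite -/Z' in e2.
  have Zw : Z + w != 0.
    by apply: Im_gt0_neq0; rewrite raddfD/= addr_gt0// (lt_le_trans eps_gt0).
  have vZ' : v + Z' != 0.
    by apply: Im_gt0_neq0; rewrite raddfD/= addr_gt0// (lt_le_trans eps_gt0).
  transitivity (Z + (w - Z) + V + (Z' - v)); first by rewrite /v; ring.
  rewrite e1 e2 /c /m1 /m2 !rmorphM/= rmorph_nat.
  by field; rewrite vZ' Zw.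
rewrite (z_increment s0 st tT) Z'E.
rewrite (_ : _ - _ = (Z - z s) + (f_int s t - (t - s)%:C * c)); last first.
  by rewrite -/h -/V; ring.
apply: (le_trans (norm1D _ _)).
set e := norm1 (Z - z s).
have eta0 : 0 <= eta.
  by apply: le_trans (zeta s _); rewrite ?norm1_ge0// lexx st.
have V_le : norm1 V <= eta + 8 * h / eps.
  have -> : V = (z t - z s) - (z t - z s - V) by ring.
  apply: (le_trans (norm1B _ _)); apply: lerD; first by rewrite zeta// st lexx.
  exact: solution_increment_le.
have M_le u : s <= u <= t ->
    norm1 (f u - c) <= 4 / eps ^+ 2 * (3 * eta + 2 * e + 12 * h / eps).
  move=> sut; have /andP[su ut] := sut.
  have epszu : eps <= complex.Im (z u).
    by rewrite Im_solution_ge// (le_trans s0 su) (le_trans ut tT).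
  have -> : f u - c = ((z u)^-1 - m1^-1) + ((z u)^-1 - m2^-1).
    by rewrite /f /c; ring.
  have d1 : norm1 (z u - m1) <= eta + e + h / eps.
    have -> : z u - m1 = (z u - z s) - (Z - z s) - (w - Z) / 2.
      by rewrite /m1; field.
    apply: (le_trans (norm1B _ _)); rewrite half.
    have := norm1B (z u - z s) (Z - z s); rewrite -/e.
    have := zeta u sut; move: wZ.
    by have -> : 2 * h / eps = 2 * (h / eps); [ring|lra].
  have d2 : norm1 (z u - m2) <= 2 * eta + e + 11 * h / eps.
    have -> : z u - m2 =
        (z u - z s) - (Z - z s) - (w - Z) - V - (Z' - v) / 2.
      by rewrite /m2 /v; field.
    apply: (le_trans (norm1B _ _)); rewrite half.
    have := norm1B (z u - z s - (Z - z s) - (w - Z)) V.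
    have := norm1B (z u - z s - (Z - z s)) (w - Z).
    have := norm1B (z u - z s) (Z - z s); rewrite -/e.
    have := zeta u sut; move: wZ Z'v V_le.
    have -> : 2 * h / eps = 2 * (h / eps) by ring.
    have -> : 8 * h / eps = 8 * (h / eps) by ring.
    have -> : 11 * h / eps = 11 * (h / eps) by ring.
    lra.
  apply: (le_trans (norm1D _ _)).
  have b1 := norm1_invB_le eps_gt0 epszu epsm1.
  have b2 := norm1_invB_le eps_gt0 epszu epsm2.
  have -> : 4 / eps ^+ 2 = (2 / eps) ^+ 2 by field; rewrite gt_eqF.
  have q0 : 0 <= (2 / eps) ^+ 2 by exact: sqr_ge0.
  have := ler_wpM2l q0 d1; have := ler_wpM2l q0 d2.
  have -> : 12 * h / eps = h / eps + 11 * h / eps by ring.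
  lra.
have := f_int_le s0 st tT M_le; rewrite -/h => h1.
apply: (le_trans (lerD (lexx _) h1)).
rewrite le_eqVlt; apply/orP; left; apply/eqP; rewrite -/e; field.
by rewrite gt_eqF.
Qed.

Section GlobalError.
Variables (t : nat -> R) (n : nat) (eta H : R).
Hypotheses (t0 : t 0%N = 0) (tS : forall i, (i < n)%N -> t i < t i.+1).
Hypotheses (tT : forall i, (i <= n)%N -> t i <= T).
Hypothesis meshH : forall i, (i < n)%N -> t i.+1 - t i <= H.
Hypothesis oscillation : forall i u, (i < n)%N -> t i <= u <= t i.+1 ->
  norm1 (z u - z (t i)) <= eta.
Let L := 16 / eps ^+ 2.
Let delta := 8 / eps ^+ 2 * (3 * eta + 12 * H / eps).

(** Discrete Gronwall argument: the amplification factors [1 + L h] multiply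
    to at most [expR (L * t j)]. *)
Lemma splitting_global_error j : (j <= n)%N ->
  norm1 (ninomiya_victoir kappa eps B t j w0 - z (t j))
  <= delta * (t j * expR (L * t j)).
Proof.
elim: j => [_|j IH jn].
  by rewrite t0 z_start /= subrr mul0r mulr0 /norm1/= normr0 addr0.
have tSj := tS jn; have {}IH := IH (ltnW jn).
have tj0 : 0 <= t j by apply: partition_ge0 => // i ij; apply/tS/(ltn_trans ij).
have h0 : 0 < t j.+1 - t j by rewrite subr_gt0.
have L0 : 0 <= L by rewrite divr_ge0// sqr_ge0.
have epsZ : eps <= complex.Im (ninomiya_victoir kappa eps B t j w0).
  by apply: Im_ninomiya_victoir_ge => // i ij; apply/tS/(ltn_trans ij).
rewrite ninomiya_victoirS.
have step := splitting_local_error tj0 (ltW tSj) (tT jn)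
  (fun u => oscillation jn (u := u)) epsZ.
apply: (le_trans step); rewrite -/L.
set e := norm1 _ in IH *.
move: (t j) (t j.+1) h0 (meshH jn) tj0 tSj IH {step epsZ} => a c.
move=> h0 hH a0 ac IH.
set h := c - a in h0 hH *.
have E1 : 1 + L * h <= expR (L * h) by exact: expR_ge1Dx.
have E2 : 1 <= expR (L * c).
  by rewrite -expR0 ler_expR mulr_ge0// ltW// (le_lt_trans a0).
have Ec : expR (L * c) = expR (L * h) * expR (L * a).
  by rewrite -expRD /h; congr expR; ring.
have q0 : 0 <= 8 / eps ^+ 2 by rewrite divr_ge0// sqr_ge0.
have d_le : 8 / eps ^+ 2 * (3 * eta + 12 * h / eps) <= delta.
  rewrite ler_wpM2l// lerD2l ler_pM2r ?invr_gt0//; lra.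
have e0 : 0 <= e by exact: norm1_ge0.
have eta0 : 0 <= eta.
  apply: le_trans (oscillation jn (u := t j) _); first exact: norm1_ge0.
  by rewrite lexx ltW// tS.
have d0 : 0 <= delta.
  have H0 : 0 <= H by exact: le_trans (ltW h0) hH.
  apply: mulr_ge0 => //; apply: addr_ge0; first by rewrite mulr_ge0.
  by apply: divr_ge0; [rewrite mulr_ge0|exact: ltW].
have Ea := expR_gt0 (L * a).
apply: (@le_trans _ _ (expR (L * h) * (delta * (a * expR (L * a)))
   + h * (delta * expR (L * c)))).
  apply: lerD; first by apply: ler_pM => //; rewrite addr_ge0// mulr_ge0// ltW.
  rewrite ler_pM2l//; apply: (le_trans d_le).
  by rewrite ler_peMr.
rewrite Ec le_eqVlt; apply/orP; left; apply/eqP.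
by rewrite [in RHS](_ : c = h + a); [ring|rewrite /h; ring].
Qed.

End GlobalError.

Definition uniform_grid (tau : R) (n i : nat) : R := tau * i%:R / n.+1%:R.

(** Only the modulus of continuity of the solution path itself enters, since
    the noise increments are differences of the path up to [O(h)]. *)
Lemma splitting_cvg tau : 0 < tau -> tau <= T -> forall e, 0 < e ->
  \forall n \near \oo,
  norm1 (ninomiya_victoir kappa eps B (uniform_grid tau n) n.+1 w0 - z tau) <= e.
Proof.
move=> tau0 tauT e e0.
pose A := 8 / eps ^+ 2 * (tau * expR (16 / eps ^+ 2 * tau)).
have A0 : 0 < A by rewrite !mulr_gt0 ?expR_gt0 ?invr_gt0 ?exprn_gt0.
(* The error bound is [A * (3 * eta + 12 * H / eps)] for steps [H]; each of the
   two summands gets half of [e]. *)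
pose eta := e / (6 * A).
have eta0 : 0 < eta / 2 by rewrite !divr_gt0// mulr_gt0.
have [cRe cIm] := z_continuous.
near (0 : R)^'+ => r.
have uRe : forall s u, s \in `[0, T] -> u \in `[0, T] -> `|s - u| < r ->
    `|complex.Re (z s) - complex.Re (z u)| <= eta / 2.
  by near: r; exact: segment_uniform_continuity cRe _ eta0.
have uIm : forall s u, s \in `[0, T] -> u \in `[0, T] -> `|s - u| < r ->
    `|complex.Im (z s) - complex.Im (z u)| <= eta / 2.
  by near: r; exact: segment_uniform_continuity cIm _ eta0.
have r0 : 0 < r by near: r; exact: nbhs_right_gt.
have e1 : 0 < e * eps / (24 * A) / tau.
  by rewrite divr_gt0// divr_gt0// mulr_gt0.
near=> n.
pose H := tau / n.+1%:R.
have n0 : 0 < n.+1%:R :> R by rewrite ltr0n.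
have n0' : n.+1%:R != 0 :> R by rewrite gt_eqF.
have Hr : H < r.
  rewrite /H mulrC -ltr_pdivlMr//; near: n.
  exact: (near_infty_natSinv_lt (PosNum (divr_gt0 r0 tau0))).
have He : H < e * eps / (24 * A).
  rewrite /H mulrC -ltr_pdivlMr//; near: n.
  exact: (near_infty_natSinv_lt (PosNum e1)).
have gridS i : uniform_grid tau n i.+1 - uniform_grid tau n i = H.
  by rewrite /uniform_grid /H -natr1; field.
have H0 : 0 < H by rewrite divr_gt0.
have gridn : uniform_grid tau n n.+1 = tau by rewrite /uniform_grid mulfK.
have gridT i : (i <= n.+1)%N -> 0 <= uniform_grid tau n i <= T.
  move=> iN; rewrite divr_ge0 ?mulr_ge0 ?ler0n ?(ltW tau0) ?(ltW n0)//=.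
  apply: le_trans tauT; rewrite ler_pdivrMr// ler_pM2l// ler_nat //.
have := @splitting_global_error (uniform_grid tau n) n.+1 eta H
  _ _ _ _ _ n.+1 (leqnn _).
rewrite gridn => /(_ _ _ _ _ _)/le_trans; apply.
- by rewrite /uniform_grid mulr0 mul0r.
- by move=> i _; rewrite -subr_gt0 gridS.
- by move=> i /gridT /andP[].
- by move=> i _; rewrite gridS.
- move=> i u iN /andP[tu ut].
  have ti := gridT i (ltnW iN); have tSi := gridT i.+1 iN.
  have tiI : uniform_grid tau n i \in `[0, T] by rewrite in_itv.
  have uI : u \in `[0, T].
    rewrite in_itv/=; case/andP: ti => ti0 _; case/andP: tSi => _ tST.
    by rewrite (le_trans ti0)// (le_trans ut).
  have du : `|u - uniform_grid tau n i| < r.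
    rewrite ger0_norm ?subr_ge0//; apply: le_lt_trans Hr.
    by rewrite -(gridS i) lerB.
  have -> : eta = 2 * (eta / 2) by field.
  by apply: norm1_le2; rewrite raddfB; [exact: uRe|exact: uIm].
- rewrite mulrAC -/A.
  have -> : e = A * (3 * eta + 12 * (e * eps / (24 * A)) / eps).
    by rewrite /eta; field; rewrite !gt_eqF.
  rewrite ler_pM2l// lerD2l ler_pM2r ?invr_gt0// ler_pM2l//.
  exact: ltW.
Unshelve. all: by end_near. Qed.

End Solution.

End Paths.

(** * Passage to the limit *)

Section ComplexLimits.
Context (R : realType).
Implicit Types (u v : nat -> R[i]) (l m : R[i]).

Definition Ccvg u l : Prop :=
  (complex.Re (u n) @[n --> \oo] --> complex.Re l) /\
  (complex.Im (u n) @[n --> \oo] --> complex.Im l).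

Lemma Ccvg_cst l : Ccvg (fun=> l) l.
Proof. by split; exact: cvg_cst. Qed.

Lemma CcvgM u v l m : Ccvg u l -> Ccvg v m -> Ccvg (fun n => u n * v n) (l * m).
Proof.
have ReM (x y : R[i]) : complex.Re (x * y) =
    complex.Re x * complex.Re y - complex.Im x * complex.Im y.
  by case: x y => [? ?] [? ?].
have ImM (x y : R[i]) : complex.Im (x * y) =
    complex.Re x * complex.Im y + complex.Im x * complex.Re y.
  by case: x y => [? ?] [? ?].
move=> [u1 u2] [v1 v2]; split.
  by rewrite ReM; under eq_fun do rewrite ReM; apply: cvgB; exact: cvgM.
by rewrite ImM; under eq_fun do rewrite ImM; apply: cvgD; exact: cvgM.
Qed.

Lemma CcvgX u l p : Ccvg u l -> Ccvg (fun n => u n ^+ p) (l ^+ p).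
Proof.
move=> ul; elim: p => [|p IH]; first exact: Ccvg_cst.
by rewrite exprS; under eq_fun do rewrite exprS; exact: CcvgM.
Qed.

Lemma norm1_Ccvg u l :
  (forall e, 0 < e -> \forall n \near \oo, norm1 (u n - l) <= e) -> Ccvg u l.
Proof.
move=> ul; split; apply/cvgrPdist_le => e e0; have := ul e e0;
  apply: filterS => n; apply: le_trans; rewrite distrC -raddfB.
  exact: normr_Re_le.
exact: normr_Im_le.
Qed.

End ComplexLimits.

Section DominatedMean.
Context (R : realType) (d : measure_display) (Omega : measurableType d)
  (P : probability Omega R).

(** The mean of the approximations does not depend on [n], so dominated
    convergence hands it on to the limit. *)
Lemma has_mean_dominated (X_ : nat -> Omega -> R[i]) (X : Omega -> R[i])
    (g : Omega -> R) (m : R[i]) :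
  Cmeasurable_fun setT X -> (forall n, Cmeasurable_fun setT (X_ n)) ->
  P.-integrable setT (EFin \o g) -> (forall n w, norm1 (X_ n w) <= g w) ->
  {ae P, forall w, Ccvg (X_ ^~ w) (X w)} ->
  (forall n, has_mean P (X_ n) m) -> has_mean P X m.
Proof.
move=> [mX1 mX2] mX_ ig X_g cvX X_m.
have gE (f : R[i] -> R) (c : R) : (forall z, `|f z| <= norm1 z) ->
    measurable_fun setT (f \o X) -> (forall n, measurable_fun setT (f \o X_ n)) ->
    {ae P, forall w, f (X_ n w) @[n --> \oo] --> f (X w)} ->
    (forall n, \int[P]_w (f (X_ n w))%:E = c%:E)%E ->
    P.-integrable setT (fun w => (f (X w))%:E) /\
    (\int[P]_w (f (X w))%:E = c%:E)%E.
  move=> fz mf mf_ cvf Ef.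
  have m_ n : measurable_fun setT (fun w => (f (X_ n w))%:E).
    by apply/measurable_EFinP; exact: mf_.
  have mE : measurable_fun setT (fun w => (f (X w))%:E).
    exact/measurable_EFinP.
  have cvE : {ae P, forall w, setT w ->
      (f (X_ n w))%:E @[n --> \oo] --> (f (X w))%:E}.
    apply: filterS cvf => w cw _.
    by apply: cvg_EFin; [exact: nearW|exact: cw].
  have leE : {ae P, forall w n, setT w -> (`|(f (X_ n w))%:E| <= (g w)%:E)%E}.
    by apply: aeW => w n _; rewrite lee_fin (le_trans (fz _)).
  have [i _ lim] := @dominated_convergence _ _ R P setT measurableT
    (fun n w => (f (X_ n w))%:E) (fun w => (f (X w))%:E) (EFin \o g)
    m_ mE cvE ig leE.
  split => //; apply/esym; apply: cvg_unique lim => //.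
  by rewrite /=; under eq_fun do rewrite Ef; exact: cvg_cst.
have ERe n : (\int[P]_w (complex.Re (X_ n w))%:E = (complex.Re m)%:E)%E.
  have [[i1 _]] := X_m n; rewrite CexpectationE /Cintegral => <- /=.
  by rewrite fineK//; exact: integrable_fin_num.
have EIm n : (\int[P]_w (complex.Im (X_ n w))%:E = (complex.Im m)%:E)%E.
  have [[_ i2]] := X_m n; rewrite CexpectationE /Cintegral => <- /=.
  by rewrite fineK//; exact: integrable_fin_num.
have cRe : {ae P, forall w,
    complex.Re (X_ n w) @[n --> \oo] --> complex.Re (X w)}.
  by apply: filterS cvX => w [].
have cIm : {ae P, forall w,
    complex.Im (X_ n w) @[n --> \oo] --> complex.Im (X w)}.
  by apply: filterS cvX => w [].
have [i1 e1] := gE _ _ (@normr_Re_le R) mX1 (fun n => (mX_ n).1) cRe ERe.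
have [i2 e2] := gE _ _ (@normr_Im_le R) mX2 (fun n => (mX_ n).2) cIm EIm.
split; first by [].
by rewrite CexpectationE /Cintegral /Rintegral e1 e2 /=; case: (m).
Qed.

End DominatedMean.

Section SolutionMoments.
Context (R : realType) (d : measure_display) (Omega : measurableType d)
  (P : probability Omega R).
Variables (kappa eps T : R) (kappa_gt0 : 0 < kappa) (eps_gt0 : 0 < eps).
Variables (B : R -> {RV P >-> R}) (B_brownian : brownian_motion B).
Variables (Z : R -> Omega -> R[i])
  (Z_solution : backward_loewner P kappa eps T (fun t w => B t w) Z).

Let grid_moments tau n : 0 < tau ->
  let NV := ninomiya_victoir kappa eps (fun t w => B t w)
              (uniform_grid tau n) n.+1 in
  [/\ Cmeasurable_fun setT NV,
      (forall w, norm1 (NV w) <= eps + 4 * tau / eps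
         + Num.sqrt kappa * `|increment (fun t w => B t w) 0 tau w|),
      has_mean P (fun w => NV w ^+ 2) (second_moment kappa eps tau)%:C &
      has_mean P (fun w => NV w ^+ 4) (fourth_moment kappa eps tau)%:C].
Proof.
move=> tau0 NV.
have n0 : 0 < n.+1%:R :> R by rewrite ltr0n.
have t0 : uniform_grid tau n 0 = 0 by rewrite /uniform_grid mulr0 mul0r.
have tn : uniform_grid tau n n.+1 = tau.
  by rewrite /uniform_grid mulfK// gt_eqF.
have tS i : (i < n.+1)%N -> uniform_grid tau n i < uniform_grid tau n i.+1.
  by move=> _; rewrite /uniform_grid ltr_pM2r ?invr_gt0// ltr_pM2l// ltr_nat.
have [m2 m4] := ninomiya_victoir_moments kappa_gt0 eps_gt0 B_brownian t0 tS.
rewrite tn in m2 m4; split => //.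
  by apply: Cmeasurable_ninomiya_victoir => i _; exact: measurable_increment.
move=> w; have := norm1_ninomiya_victoir_le_increment kappa eps_gt0 B t0 w tS.
by rewrite tn.
Qed.

Let grid_cvg tau : 0 < tau -> tau <= T -> {ae P, forall w,
  Ccvg (fun n => ninomiya_victoir kappa eps (fun t w => B t w)
                   (uniform_grid tau n) n.+1 w) (Z tau w)}.
Proof.
move=> tau0 tauT.
have start := loewner_start Z_solution.
have cont := loewner_continuous Z_solution.
have upper := loewner_upper Z_solution.
have eqn := loewner_equation Z_solution.
apply: filterS (filterI (filterI start cont) (filterI upper eqn)).
move=> w [[Z0 cZ] [uZ eZ]]; apply: norm1_Ccvg.
exact: (splitting_cvg eps_gt0 Z0 cZ uZ eZ tau0 tauT).
Qed.

(** The moments of the solution are limits of those of the scheme on finer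
    and finer uniform grids; for [tau = 0] the initial value is constant. *)
Lemma solution_moments tau : 0 <= tau <= T ->
  has_mean P (fun w => Z tau w ^+ 2) (second_moment kappa eps tau)%:C /\
  has_mean P (fun w => Z tau w ^+ 4) (fourth_moment kappa eps tau)%:C.
Proof.
move=> tauT; have mZ := loewner_measurable Z_solution tauT.
move: tauT => /andP[]; rewrite le_eqVlt => /predU1P[tau0 _|tau0 tauT].
  subst tau; have t00 : (0 : R) = 0 := erefl.
  have [m2 m4] := ninomiya_victoir_moments (k := 0) kappa_gt0 eps_gt0 B_brownian
    (t := fun=> 0) t00 (fun i i0 => False_ind _ (notF i0)).
  have start p : {ae P, forall w, Ccvg (fun=> (0 +i* eps) ^+ p) (Z 0 w ^+ p)}.
    apply: filterS (loewner_start Z_solution) => w ->.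
    exact: Ccvg_cst.
  have bounded (c : R[i]) : P.-integrable setT (EFin \o fun=> norm1 c).
    by have [[+ _] _] := has_mean_cst P (norm1 c)%:C.
  split.
    apply: (has_mean_dominated (X_ := fun _ _ => (0 +i* eps) ^+ 2)
      (CmeasurableX _ mZ) (fun=> Cmeasurable_cst _ _) (bounded _) _ (start 2)) => //.
  apply: (has_mean_dominated (X_ := fun _ _ => (0 +i* eps) ^+ 4)
    (CmeasurableX _ mZ) (fun=> Cmeasurable_cst _ _) (bounded _) _ (start 4)) => //.
have a0 : 0 <= eps + 4 * tau / eps by rewrite addr_ge0 ?divr_ge0 ?mulr_ge0// ltW.
have tau00 : 0 <= (0 : R) <= tau by rewrite lexx (ltW tau0).
have ig := integrable_quartic_bound B_brownian (eps + 4 * tau / eps)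
  (Num.sqrt kappa) tau00.
pose NV n := ninomiya_victoir kappa eps (fun t w => B t w)
  (uniform_grid tau n) n.+1.
have bnd p n w : (p <= 4)%N -> norm1 (NV n w ^+ p) <= quartic_bound
    (eps + 4 * tau / eps) (Num.sqrt kappa) (increment (fun t w => B t w) 0 tau w).
  move=> p4; rewrite (le_trans (norm1X _ _))//.
  have [_ b _ _] := grid_moments n tau0.
  exact: (exprn_le_quartic_bound a0 (sqrtr_ge0 kappa) (norm1_ge0 _) (b w) p4).
have cv p : {ae P, forall w, Ccvg (fun n => NV n w ^+ p) (Z tau w ^+ p)}.
  by apply: filterS (grid_cvg tau0 tauT) => w; exact: CcvgX.
split.
  apply: (has_mean_dominated (X_ := fun n w => NV n w ^+ 2) (CmeasurableX _ mZ)
    _ ig _ (cv 2)).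
  - by move=> n; apply: CmeasurableX; have [] := grid_moments n tau0.
  - by move=> n w; exact: bnd.
  - by move=> n; have [] := grid_moments n tau0.
apply: (has_mean_dominated (X_ := fun n w => NV n w ^+ 4) (CmeasurableX _ mZ)
  _ ig _ (cv 4)).
- by move=> n; apply: CmeasurableX; have [] := grid_moments n tau0.
- by move=> n w; exact: bnd.
- by move=> n; have [] := grid_moments n tau0.
Qed.

End SolutionMoments.

Theorem theorem6p4 (R : realType) (d : measure_display)
    (Omega : measurableType d) (P : probability Omega R)
    (kappa eps T : R) (kappa_gt0 : 0 < kappa) (eps_gt0 : 0 < eps)
    (T_gt0 : 0 < T)
    (B : R -> {RV P >-> R}) (B_brownian : brownian_motion B)
    (Z : R -> Omega -> R[i])
    (Z_solution : backward_loewner P kappa eps T (fun t w => B t w) Z)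
    (N : nat) (t : nat -> R) (t_partition : is_partition T N t)
    (k : nat) (k_le_N : (k <= N)%N) :
  let Ztilde := ninomiya_victoir kappa eps (fun t w => B t w) t k in
  [/\ Cintegrable P setT (fun w => Ztilde w ^+ 2),
      Cintegrable P setT (fun w => Z (t k) w ^+ 2) &
      Cexpectation P (fun w => Ztilde w ^+ 2) =
      Cexpectation P (fun w => Z (t k) w ^+ 2)] /\
  [/\ Cintegrable P setT (fun w => Ztilde w ^+ 4),
      Cintegrable P setT (fun w => Z (t k) w ^+ 4) &
      Cexpectation P (fun w => Ztilde w ^+ 4) =
      Cexpectation P (fun w => Z (t k) w ^+ 4)].
Proof.
move=> Ztilde; case: t_partition => t0 tN tS.
have tSk i : (i < k)%N -> t i < t i.+1.
  by move=> ik; apply: tS; exact: leq_trans k_le_N.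
have tk0 : 0 <= t k by exact: partition_ge0.
have tkT : t k <= T.
  rewrite -tN; elim: N k_le_N tS {tN} => [|n IH].
    by rewrite leqn0 => /eqP ->.
  rewrite leq_eqVlt => /predU1P[-> //|kn] tS.
  rewrite (le_trans (IH kn _))// => [i ni|]; last by rewrite ltW// tS.
  by apply: tS; exact: ltnW.
have [[i2 e2] [i4 e4]] :=
  ninomiya_victoir_moments kappa_gt0 eps_gt0 B_brownian t0 tSk.
have tk : 0 <= t k <= T by rewrite tk0 tkT.
have [[j2 f2] [j4 f4]] :=
  solution_moments kappa_gt0 eps_gt0 B_brownian Z_solution tk.
by split; split => //; rewrite ?e2 ?e4 ?f2 ?f4.
Qed.
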